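(* Let $G$ be an amenable countable discrete group and $1<p<\infty$. Let $Y_p$ be the closed unit ball of $A_p(G)^*$, $X_p=\mathrm{span}\{\delta_x:x\in G\}$ with $\delta_x(f)=f(x)$, and $Z_p=X_p\cap Y_p$. Then the following are equivalent: (i) $A_p(G)$ is Arens regular. (ii) For all sequences $(f_n)$, $(g_m)$ in the closed unit ball of $A_p(G)$ and every sequence $(\phi_k)$ in $Z_p$, $\lim_n\lim_m\lim_k\phi_k(f_ng_m)=\lim_m\lim_n\lim_k\phi_k(f_ng_m)$ whenever both iterated limits exist. (iii) For all sequences $(f_n)$, $(g_m)$ in the closed unit ball of $A_p(G)$ and every sequence $(\phi_k)$ in $Z_p$, $\overline{\{\phi_k(f_ng_m): k>n>m\}}\cap\overline{\{\phi_k(f_ng_m): k>m>n\}}\neq\emptyset$ (closures in $\mathbb{C}$).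
   Context: For a discrete group $G$ and $1<p<\infty$, $\frac1p+\frac1q=1$, $A_p(G)$ is the space of functions $u=\sum_{i=1}^\infty g_i*f_i^{\vee}$ with $f_i\in \ell_p(G)$, $g_i\in \ell_q(G)$, $\sum_i\|f_i\|_p\|g_i\|_q<\infty$, where $f^{\vee}(x)=f(x^{-1})$; with pointwise multiplication and norm $\|u\|_{A_p(G)}=\inf\{\sum_i\|f_i\|_p\|g_i\|_q\}$ it is a commutative Banach algebra (the Herz algebra); its dual is identified with $PM_p(G)$, the weak-operator closure of $\ell_1(G)$ acting by convolution on $\ell_p(G)$. A Banach algebra $A$ is Arens regular if the two Arens products on $A^{**}$ coincide; equivalently, for all sequences $(a_n),(b_m)$ in the closed unit ball of $A$ and all $T\in A^*$, $\lim_n\lim_m T(a_nb_m)=\lim_m\lim_n T(a_nb_m)$ whenever both exist. *)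

(* Defs.v *)
From HB Require Import structures.
From mathcomp Require Import all_boot all_order all_algebra.
From mathcomp Require Import complex.
From mathcomp Require Import all_classical all_reals all_analysis.

Set Implicit Arguments.
Unset Strict Implicit.
Unset Printing Implicit Defensive.

Import Order.TTheory GRing.Theory Num.Theory.
Import numFieldNormedType.Exports.
Local Open Scope ring_scope.
Local Open Scope classical_set_scope.

(* The complex numbers over R, seen as a numClosedFieldType so that
   MathComp-Analysis equips them with their usual (metric) topology. *)
Definition Cx (R : realType) : numClosedFieldType := R[i].

Section Herz.
Variables (R : realType) (G : groupType).
Local Notation C := (Cx R).

Definition cabs (z : C) : R := Normc.normc z.

Definition has_sumG (F : G -> C) (l : C) : Prop :=
  forall e : R, 0 < e -> exists A : set G, finite_set A /\
    forall B : set G, finite_set B -> A `<=` B ->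
      cabs (l - \sum_(x \in B) F x) < e.

Definition sumG (F : G -> C) : C := xget 0 [set l | has_sumG F l].

Definition conj_exp (p : R) : R := p / (p - 1).

Definition lp_sum (p : R) (f : G -> C) : \bar R :=
  \esum_(x in [set: G]) ((cabs (f x)) `^ p)%:E.

Definition in_lp (p : R) (f : G -> C) : Prop := (lp_sum p f < +oo)%E.

Definition lp_norm (p : R) (f : G -> C) : R := (fine (lp_sum p f)) `^ (p^-1).

Definition check (f : G -> C) : G -> C := fun x => f (x^-1)%g.

Definition conv (g h : G -> C) : G -> C :=
  fun x => sumG (fun y => g y * h (y^-1 * x)%g).

Definition Ap_rep (p : R) (u : G -> C) (f g : nat -> G -> C) : Prop :=
  [/\ forall i, in_lp p (f i),
      forall i, in_lp (conj_exp p) (g i),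
      (\esum_(i in [set: nat]) (lp_norm p (f i) * lp_norm (conj_exp p) (g i))%:E
         < +oo)%E
    & forall x, (fun n => \sum_(0 <= i < n) conv (g i) (check (f i)) x)
                  @ \oo --> u x].

Definition in_Ap (p : R) (u : G -> C) : Prop := exists f g, Ap_rep p u f g.

Definition Ap_norm (p : R) (u : G -> C) : R :=
  inf [set r : R | exists f g, Ap_rep p u f g /\
         r = fine (\esum_(i in [set: nat])
                     (lp_norm p (f i) * lp_norm (conj_exp p) (g i))%:E)].

Definition pmul (u v : G -> C) : G -> C := fun x => u x * v x.

Definition Ap_ball (p : R) (u : G -> C) : Prop := in_Ap p u /\ Ap_norm p u <= 1.

(* functionals are functions on G -> C; only their values on A_p(G) matter *)
Definition Ap_linear (p : R) (T : (G -> C) -> C) : Prop :=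
  forall (a : C) u v, in_Ap p u -> in_Ap p v ->
    T (fun x => a * u x + v x) = a * T u + T v.

Definition in_Ap_dual (p : R) (T : (G -> C) -> C) : Prop :=
  Ap_linear p T /\
  exists M : R, forall u, in_Ap p u -> cabs (T u) <= M * Ap_norm p u.

Definition Ap_dual_norm (p : R) (T : (G -> C) -> C) : R :=
  sup ((fun u => cabs (T u)) @` Ap_ball p).

Definition in_Yp (p : R) (T : (G -> C) -> C) : Prop :=
  in_Ap_dual p T /\ Ap_dual_norm p T <= 1.

Definition in_Xp (p : R) (T : (G -> C) -> C) : Prop :=
  exists s : seq (C * G), forall u, in_Ap p u ->
    T u = \sum_(c <- s) c.1 * u c.2.

Definition in_Zp (p : R) (T : (G -> C) -> C) : Prop := in_Xp p T /\ in_Yp p T.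

(* elements of A^** : bounded linear functionals on A^*, depending only on
   the class of a functional (its values on A_p(G)) *)
Definition in_Ap_bidual (p : R) (F : ((G -> C) -> C) -> C) : Prop :=
  [/\ forall (a : C) T S, in_Ap_dual p T -> in_Ap_dual p S ->
        F (fun u => a * T u + S u) = a * F T + F S,
      forall T S, (forall u, in_Ap p u -> T u = S u) -> F T = F S
    & exists M : R, forall T, in_Ap_dual p T ->
        cabs (F T) <= M * Ap_dual_norm p T].

Definition dual_rmul (T : (G -> C) -> C) (a : G -> C) : (G -> C) -> C :=
  fun b => T (pmul a b).
Definition dual_lmul (a : G -> C) (T : (G -> C) -> C) : (G -> C) -> C :=
  fun b => T (pmul b a).
Definition bidual_dual (F : ((G -> C) -> C) -> C) (T : (G -> C) -> C) :
  (G -> C) -> C := fun a => F (dual_rmul T a).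
Definition dual_bidual (T : (G -> C) -> C) (F : ((G -> C) -> C) -> C) :
  (G -> C) -> C := fun a => F (dual_lmul a T).
Definition arens1 (F H : ((G -> C) -> C) -> C) : ((G -> C) -> C) -> C :=
  fun T => F (bidual_dual H T).
Definition arens2 (F H : ((G -> C) -> C) -> C) : ((G -> C) -> C) -> C :=
  fun T => H (dual_bidual T F).

Definition Ap_Arens_regular (p : R) : Prop :=
  forall F H, in_Ap_bidual p F -> in_Ap_bidual p H ->
    forall T, in_Ap_dual p T -> arens1 F H T = arens2 F H T.

Definition iterlim_nmk (a : nat -> nat -> nat -> C) (L : C) : Prop :=
  exists (b : nat -> nat -> C) (c : nat -> C),
    [/\ forall n m, a n m @ \oo --> b n m,
        forall n, b n @ \oo --> c n
      & c @ \oo --> L].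

Definition iterlim_mnk (a : nat -> nat -> nat -> C) (L : C) : Prop :=
  exists (b : nat -> nat -> C) (d : nat -> C),
    [/\ forall n m, a n m @ \oo --> b n m,
        forall m, (fun n => b n m) @ \oo --> d m
      & d @ \oo --> L].

Definition bounded_fun (f : G -> R) : Prop := exists M : R, forall x, `|f x| <= M.

Definition amenable : Prop :=
  exists m : (G -> R) -> R,
    [/\ forall (a : R) f h, bounded_fun f -> bounded_fun h ->
          m (fun x => a * f x + h x) = a * m f + m h,
        forall f, bounded_fun f -> (forall x, 0 <= f x) -> 0 <= m f,
        m (fun _ => 1) = 1
      & forall f y, bounded_fun f -> m (fun x => f (y * x)%g) = m f].

End Herz.

(* Main.v *)
Require Import Defs.
From HB Require Import structures.
From mathcomp Require Import all_boot all_order all_algebra.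
From mathcomp Require Import complex.
From mathcomp Require Import all_classical all_reals all_analysis.
From mathcomp Require Import ring lra.
Import Order.TTheory GRing.Theory Num.Theory.
Import numFieldNormedType.Exports.
Local Open Scope ring_scope.
Local Open Scope classical_set_scope.

(** (i) => (ii): limits of [phi_k], [f_n] and [g_m] along a free ultrafilter give
    an element [T] of the dual and two elements of the bidual whose Arens
    products at [T] are the two iterated limits.

    (ii) => (iii): everything is bounded by 1, so a diagonal extraction makes all
    the iterated limits exist; their common value lies in both closures.

    (iii) => (i): if the two Arens products of [F] and [H] differ at [T], Helly's
    theorem yields sequences [f_n] and [g_m] in the ball such that [T (f_n g_m)]
    is close to one product (up to scaling) for [n < m] and to the other one for
    [m < n]. Amenability gives Reiter's condition, hence an approximate identity
    of finitely supported functions [v] in the ball, and [u |-> T (v u)] is then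
    a combination of point evaluations that approximates [T] on the finitely many
    products of index less than [k]. After scaling by the norm of [T] this is
    [phi_k], and the two closures are disjoint.

    Representations of elements of Ap(G) are indexed by arbitrary countable sets:
    the product of [g * f^v] and [k * h^v] is the sum over [t] in [G] of
    [(g . R_t k) * (f . R_t h)^v] where [R_t k (y) = k (y t)], and Hölder's
    inequality in [t] bounds its norm. *)

Set Implicit Arguments.
Unset Strict Implicit.
Unset Printing Implicit Defensive.

(** * Complex modulus *)

Section ComplexModulus.
Variable R : realType.
Implicit Types (z w : Cx R) (r : R).

(** The pointwise product is commutative, so the second Arens product of [F] and [H] is the first
    one of [H] and [F]; what (iii) has to detect is the order in which [F] and [H] are applied to
    [T]. Sequences suffice because every choice meets finitely many conditions: a new [f_n] or [g_n]
    imitates [F] or [H] on finitely many functionals, and [phi_k] imitates [T] on finitely many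
    products. The delicate point is to make [T] finitely supported without raising its norm.
    Truncating [T] gives no control, whereas [u |-> T (v u)] has norm at most that of [T] when [v]
    is in the ball. Such a [v] is the convolution of mu^(1/q) with the reflection of mu^(1/p), for
    an almost invariant probability mu: the two factors have norm 1, and v(x) - 1 is a pairing of
    mu^(1/q) with a translation difference of mu^(1/p). Two infima need not be attained, the norm of
    Ap(G) and the distance in the Helly argument. Strict bounds with a slack replace the first, near
    minimizers with an error fixed in advance replace the second. *)

Definition ofR r : Cx R := (r%:C)%C.

Lemma normE z : `|z| = ofR (cabs z). Proof. by []. Qed.

Lemma ofR0 : ofR 0 = 0. Proof. by []. Qed.
Lemma ofR1 : ofR 1 = 1. Proof. by []. Qed.
Lemma ofRD r s : ofR (r + s) = ofR r + ofR s.
Proof. exact: (rmorphD (real_complex R)). Qed.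
Lemma ofRN r : ofR (- r) = - ofR r.
Proof. exact: (rmorphN (real_complex R)). Qed.
Lemma ofRM r s : ofR (r * s) = ofR r * ofR s.
Proof. exact: (rmorphM (real_complex R)). Qed.
Lemma ofR_inj : injective ofR.
Proof. by move=> r s []. Qed.

Lemma cabs_ge0 z : 0 <= cabs z.
Proof. by case: z => a b; rewrite /cabs /= sqrtr_ge0. Qed.

Lemma cabs0 : cabs (0 : Cx R) = 0. Proof. exact: Normc.normc0. Qed.
Lemma cabs1 : cabs (1 : Cx R) = 1. Proof. exact: Normc.normc1. Qed.
Lemma cabsM z w : cabs (z * w) = cabs z * cabs w.
Proof. exact: Normc.normcM. Qed.
Lemma cabsN z : cabs (- z) = cabs z.
Proof. exact: normcN. Qed.
Lemma cabsD z w : cabs (z + w) <= cabs z + cabs w.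
Proof. exact: le_normcD. Qed.
Lemma cabsB z w : cabs (z - w) <= cabs z + cabs w.
Proof. by rewrite -(cabsN w); exact: cabsD. Qed.
Lemma cabs_distC z w : cabs (z - w) = cabs (w - z).
Proof. by rewrite -cabsN opprB. Qed.
Lemma cabs_eq0 z : cabs z = 0 -> z = 0.
Proof. exact: Normc.eq0_normc. Qed.
Lemma cabsV z : cabs z^-1 = (cabs z)^-1.
Proof. exact: Normc.normcV. Qed.
Lemma cabs_ofR r : cabs (ofR r) = `|r|.
Proof. by rewrite /cabs /= expr0n /= addr0 sqrtr_sqr. Qed.
Lemma cabs_triangle z w v : cabs (z - v) <= cabs (z - w) + cabs (w - v).
Proof. by have := cabsD (z - w) (w - v); rewrite addrA subrK. Qed.

Lemma cabs_sum (I : Type) (s : seq I) (F : I -> Cx R) :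
  cabs (\sum_(i <- s) F i) <= \sum_(i <- s) cabs (F i).
Proof.
elim: s => [|i s IH]; first by rewrite !big_nil cabs0.
by rewrite !big_cons (le_trans (cabsD _ _))// lerD2l.
Qed.

Lemma cabs_Re z : `|complex.Re z| <= cabs z.
Proof.
case: z => a b; rewrite /cabs /= -sqrtr_sqr ler_wsqrtr //.
by rewrite lerDl sqr_ge0.
Qed.
Lemma cabs_Im z : `|complex.Im z| <= cabs z.
Proof.
case: z => a b; rewrite /cabs /= -sqrtr_sqr ler_wsqrtr //.
by rewrite lerDr sqr_ge0.
Qed.

Lemma complex_decomp z :
  z = ofR (complex.Re z) + (0 +i* 1)%C * ofR (complex.Im z).
Proof. exact: complexE. Qed.

Lemma cabs_i : cabs (0 +i* 1 : Cx R)%C = 1.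
Proof. by rewrite /cabs /= expr0n /= add0r expr1n sqrtr1. Qed.

Lemma cabs_small_eq z w : (forall e : R, 0 < e -> cabs (z - w) < e) -> z = w.
Proof.
move=> h; apply/eqP; rewrite -subr_eq0; apply/eqP/cabs_eq0/eqP.
rewrite eq_le cabs_ge0 andbT leNgt; apply/negP => /h.
by rewrite ltxx.
Qed.

(** The norm of [Cx R] is [Cx R]-valued, and so are the radii of its balls. A positive element of
    [Cx R] has zero imaginary part, so its real part can serve as a real radius. *)
Lemma cvg_cabsP (a : nat -> Cx R) (l : Cx R) :
  (a @ \oo --> l) <->
  (forall e : R, 0 < e -> exists N, forall n, (N <= n)%N -> cabs (l - a n) < e).
Proof.
split.
- move=> /cvgrPdist_lt h e e0.
  have /h[N _ hN] : 0 < ofR e by rewrite (ltcR 0 e).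
  by exists N => n /hN /=; rewrite normE (ltcR _ e).
- move=> h; apply/cvgrPdist_lt => e e0.
  move: (e0); rewrite ltcE /= => /andP[/eqP ie re].
  have [N hN] := h _ re; exists N => // n /hN /=.
  by rewrite normE ltcE /= ie eqxx.
Qed.

Lemma closure_cabsP (A : set (Cx R)) (l : Cx R) :
  closure A l <-> (forall e : R, 0 < e -> exists2 z, A z & cabs (l - z) < e).
Proof.
split.
- move=> h e e0; have [|z [Az hz]] := h (ball l (ofR e)).
    by apply: nbhsx_ballx; rewrite (ltcR 0 e).
  by exists z => //; move: hz; rewrite -ball_normE /= normE (ltcR _ e).
- move=> h B /nbhs_ballP[e e0 eB].
  move: (e0); rewrite /= ltcE /= => /andP[/eqP ie re].
  have [z Az hz] := h _ re; exists z; split => //; apply: eB.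
  by rewrite -ball_normE /= normE ltcE /= ie eqxx.
Qed.

End ComplexModulus.

(** * Unordered sums of non-negative reals *)

(* Locked, so that failing unifications do not unfold suprema. *)
HB.lock Definition esumT (R : realType) (I : choiceType) (f : I -> R) : \bar R :=
  \esum_(i in [set: I]) (f i)%:E.

HB.lock Definition rsum (R : realType) (I : choiceType) (f : I -> R) : R :=
  fine (esumT f).

Section NonnegSums.
Variable R : realType.

Lemma esumT_def (I : choiceType) (f : I -> R) :
  esumT f = \esum_(i in [set: I]) (f i)%:E.
Proof. by rewrite esumT.unlock. Qed.

Lemma rsum_def (I : choiceType) (f : I -> R) : rsum f = fine (esumT f).
Proof. by rewrite rsum.unlock. Qed.

Definition summ (I : choiceType) (f : I -> R) : Prop :=
  (forall i, 0 <= f i) /\ (esumT f < +oo)%E.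

Section OneIndex.
Variable I : choiceType.
Implicit Types f g : I -> R.

Lemma esumT_ge0 f : (forall i, 0 <= f i) -> (0 <= esumT f)%E.
Proof. by move=> f0; rewrite esumT_def; apply: esum_ge0 => i _; rewrite lee_fin. Qed.

Lemma esumTE f : summ f -> esumT f = (rsum f)%:E.
Proof.
by move=> [f0 fy]; rewrite rsum_def fineK// ge0_fin_numE// esumT_ge0.
Qed.

Lemma rsum_ge0 f : (forall i, 0 <= f i) -> 0 <= rsum f.
Proof. by move=> f0; rewrite rsum_def fine_ge0// esumT_ge0. Qed.

Lemma summ_bound f M : (forall i, 0 <= f i) ->
  (forall A : set I, finite_set A -> \sum_(i \in A) f i <= M) ->
  summ f /\ rsum f <= M.
Proof.
move=> f0 fM.
have le : (esumT f <= M%:E)%E.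
  rewrite esumT_def; apply: ge_ereal_sup => _ [A [finA _]] <-.
  by rewrite fsumEFin// lee_fin fM.
have s : summ f by split=> //; exact: le_lt_trans le (ltry _).
by split=> //; rewrite -lee_fin -esumTE.
Qed.

Lemma fsum_le_rsum f A : summ f -> finite_set A ->
  \sum_(i \in A) f i <= rsum f.
Proof.
move=> sf fA; rewrite -lee_fin -esumTE// -fsumEFin//.
by rewrite esumT_def; apply: esum_ge; exists A.
Qed.

Lemma le_rsum1 f i : summ f -> f i <= rsum f.
Proof.
by move=> sf; have := fsum_le_rsum sf (finite_set1 i); rewrite fsbig_set1.
Qed.

Lemma rsum_approx f e : summ f -> 0 < e ->
  exists2 A, finite_set A & rsum f - e < \sum_(i \in A) f i.
Proof.
move=> sf e0.
have : ((rsum f - e)%:E < esumT f)%E by rewrite esumTE// lte_fin ltrBlDr ltrDl.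
rewrite esumT_def => /ereal_sup_gt[_ [A [fA _] <-]]; rewrite fsumEFin// lte_fin => h.
by exists A.
Qed.

Lemma summ_le f g : (forall i, 0 <= f i <= g i) -> summ g ->
  summ f /\ rsum f <= rsum g.
Proof.
move=> fg sg; apply: summ_bound => [i|A fA]; first by case/andP: (fg i).
apply: le_trans (fsum_le_rsum sg fA).
by rewrite !fsbig_finite//=; apply: ler_sum => i _; case/andP: (fg i).
Qed.

Lemma summD f g : summ f -> summ g ->
  summ (fun i => f i + g i) /\ rsum (fun i => f i + g i) = rsum f + rsum g.
Proof.
move=> sf sg; have [f0 _] := sf; have [g0 _] := sg.
have E : esumT (fun i => f i + g i) = (rsum f + rsum g)%:E.
  rewrite EFinD -!esumTE// !esumT_def -esumD; first by apply: eq_esum.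
  - by move=> i _; rewrite lee_fin.
  - by move=> i _; rewrite lee_fin.
split; first by split=> [i|]; [exact: addr_ge0|rewrite E ltry].
by rewrite rsum_def E.
Qed.

Lemma summ0 : summ (fun _ : I => 0 : R) /\ rsum (fun _ : I => 0 : R) = 0.
Proof.
have E : esumT (fun _ : I => 0 : R) = 0%E by rewrite esumT_def esum1.
by rewrite /summ rsum_def E ltry.
Qed.

Lemma summZ c f : 0 <= c -> summ f ->
  summ (fun i => c * f i) /\ rsum (fun i => c * f i) = c * rsum f.
Proof.
rewrite le_eqVlt => /predU1P[<-|c0] sf.
  rewrite mul0r; under eq_fun do rewrite mul0r.
  exact: summ0.
(* One inequality is enough: applied again with [c^-1] to the scaled family, it gives the reverse
   one. *)
have key d g : 0 < d -> summ g ->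
    summ (fun i => d * g i) /\ rsum (fun i => d * g i) <= d * rsum g.
  move=> d0 sg; have [g0 _] := sg.
  apply: summ_bound => [i|A fA]; first by rewrite mulr_ge0// ltW.
  by rewrite -mulr_fsumr ler_pM2l// fsum_le_rsum.
have [s1 h1] := key c f c0 sf; split=> //; apply/eqP; rewrite eq_le h1 /=.
have [_] := key c^-1 _ (ltac:(by rewrite invr_gt0)) s1.
under [X in rsum X]eq_fun do rewrite mulrA mulVf ?gt_eqF// mul1r.
by rewrite ler_pdivlMl.
Qed.

Lemma summ_cut (A : set I) f : summ f ->
  summ (fun i => if i \in A then f i else 0) /\
  summ (fun i => if i \in A then 0 else f i).
Proof.
move=> sf; have [f0 _] := sf.
by split; [apply: (proj1 (summ_le _ sf))|apply: (proj1 (summ_le _ sf))] => i;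
   case: ifP; rewrite lexx f0.
Qed.

Lemma rsum_tail f e : summ f -> 0 < e ->
  exists2 A : set I, finite_set A & rsum (fun i => if i \in A then 0 else f i) < e.
Proof.
move=> sf e0; have [A fA hA] := rsum_approx sf e0; exists A => //.
have [s1 s2] := summ_cut A sf.
have [_] := summD s1 s2.
have -> : (fun i => (if i \in A then f i else 0) + (if i \in A then 0 else f i)) = f.
  by apply/funext => i; case: ifP; rewrite ?addr0 ?add0r.
move=> E; have := fsum_le_rsum s1 fA.
rewrite (_ : \sum_(i \in A) (if i \in A then f i else 0) = \sum_(i \in A) f i).
  lra.
by apply: eq_fsbigr => i ->.
Qed.

End OneIndex.

Lemma esumT_inj (I J : choiceType) (e : I -> J) (f : J -> R) :
  injective e -> (forall j, (forall i, e i <> j) -> f j = 0) ->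
  esumT f = esumT (f \o e).
Proof.
move=> ei f0; rewrite !esumT_def -(esum_image [set: I] e (fun j => (f j)%:E)); last first.
  by move=> x y _ _; exact: ei.
rewrite [RHS]esum_mkcond; apply: eq_esum => j _; case: ifPn => // /negP hj.
by rewrite f0// => i ij; apply: hj; rewrite inE; exists i.
Qed.

Lemma summ_inj (I J : choiceType) (e : I -> J) (f : J -> R) :
  injective e -> (forall j, (forall i, e i <> j) -> f j = 0) ->
  (summ f <-> summ (f \o e)) /\ rsum f = rsum (f \o e).
Proof.
move=> ei f0; rewrite /summ !rsum_def (esumT_inj ei f0); split=> //.
split=> -[h1 h2]; split=> // j; first exact: h1.
have [[i <-]|/forallNP h] := pselect (exists i, e i = j); first exact: h1.
by rewrite f0.
Qed.

Lemma summ_bij (I J : choiceType) (e : I -> J) (f : J -> R) : bijective e ->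
  (summ f <-> summ (f \o e)) /\ rsum f = rsum (f \o e).
Proof.
move=> be; apply: summ_inj; first exact: bij_inj.
by move=> j; case: be => e' _ e'K /(_ (e' j)); rewrite e'K.
Qed.

Lemma summ_pair (I J : choiceType) (f : I * J -> R) :
  summ f -> [/\ forall i, summ (fun j => f (i, j)),
    summ (fun i => rsum (fun j => f (i, j))) &
    rsum f = rsum (fun i => rsum (fun j => f (i, j)))].
Proof.
move=> sf; have [f0 _] := sf.
have s1 i : summ (fun j => f (i, j)).
  apply: (proj1 (@summ_bound _ _ (rsum f) _ _)) => // A fA.
  rewrite (_ : \sum_(j \in A) f (i, j) = \sum_(k \in [set (i, j) | j in A]) f k).
    apply: fsum_le_rsum => //; exact: finite_image.
  rewrite (reindex_fsbig (fun j => (i, j)) A)//.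
  by split=> [x Ax|x y _ _ [//]|x [y Ay <-]]; [exists x|exists y].
have E : esumT (fun i => rsum (fun j => f (i, j))) = esumT f.
  transitivity (\esum_(i in [set: I]) \esum_(j in [set: J]) (f (i, j))%:E)%E.
    by rewrite [LHS]esumT_def; apply: eq_esum => i _; rewrite -esumTE// esumT_def.
  rewrite (@esum_esum R I J setT (fun=> setT) (fun i j => (f (i, j))%:E)).
    rewrite esumT_def; have -> : [set: I] `*`` (fun=> [set: J]) = setT.
      by apply/seteqP; split.
    by apply: eq_esum => -[i j].
  by move=> i j _ _; rewrite lee_fin.
split=> //; last by rewrite !rsum_def -E.
split=> [i|]; first by apply: rsum_ge0 => j; exact: f0.
by rewrite E; case: sf.
Qed.

Lemma pair_summ (I J : choiceType) (f : I * J -> R) :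
  (forall i, summ (fun j => f (i, j))) ->
  summ (fun i => rsum (fun j => f (i, j))) -> summ f.
Proof.
move=> s1 [_ s2]; have f0 k : 0 <= f k by case: k => i j; exact: (proj1 (s1 i)).
split=> //.
suff <- : esumT (fun i => rsum (fun j => f (i, j))) = esumT f by [].
transitivity (\esum_(i in [set: I]) \esum_(j in [set: J]) (f (i, j))%:E)%E.
  by rewrite [LHS]esumT_def; apply: eq_esum => i _; rewrite -esumTE// esumT_def.
rewrite (@esum_esum R I J setT (fun=> setT) (fun i j => (f (i, j))%:E)).
  rewrite esumT_def; have -> : [set: I] `*`` (fun=> [set: J]) = setT.
    by apply/seteqP; split.
  by apply: eq_esum => -[i j].
by move=> i j _ _; rewrite lee_fin.
Qed.

End NonnegSums.

(** * Unordered sums of complex numbers *)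

(** The summation of [has_sumG] over an arbitrary index type, since sums over [I * G] are needed.
    Over [G], [csum] unfolds to [sumG], which is how [convE] connects the two. *)
Definition hsum (R : realType) (I : choiceType) (F : I -> Cx R) (l : Cx R) : Prop :=
  forall e : R, 0 < e -> exists A : set I, finite_set A /\
    forall B : set I, finite_set B -> A `<=` B ->
      cabs (l - \sum_(x \in B) F x) < e.

HB.lock Definition csum (R : realType) (I : choiceType) (F : I -> Cx R) : Cx R :=
  xget 0 [set l | hsum F l].

Section ComplexSums.
Variable R : realType.
Local Notation C := (Cx R).

Definition absum (I : choiceType) (F : I -> C) : Prop := summ (@cabs R \o F).

Section OneIndex.
Variable I : choiceType.
Implicit Types (F G : I -> C) (f : I -> R).

Lemma hsum_uniq F l l' : hsum F l -> hsum F l' -> l = l'.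
Proof.
move=> h h'; apply: cabs_small_eq => e e0.
have e2 : 0 < e / 2 by rewrite divr_gt0.
have [A [fA hA]] := h _ e2; have [B [fB hB]] := h' _ e2.
have fAB : finite_set (A `|` B) by rewrite finite_setU.
have := hA _ fAB (@subsetUl _ _ _); have := hB _ fAB (@subsetUr _ _ _).
move: (cabs_triangle l (\sum_(x \in A `|` B) F x) l').
rewrite (cabs_distC (\sum_(x \in A `|` B) F x) l'); lra.
Qed.

Lemma hsum_csum F l : hsum F l -> csum F = l.
Proof.
move=> h; rewrite csum.unlock; case: xgetP => [l' -> h'|/(_ l)//].
exact: hsum_uniq h' h.
Qed.

Lemma hsum_lin a F G l l' : hsum F l -> hsum G l' ->
  hsum (fun i => a * F i + G i) (a * l + l').
Proof.
move=> h h' e e0.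
have d0 : 0 < 2 * (cabs a + 1) by have := cabs_ge0 a; lra.
have [A [fA hA]] := h (e / (2 * (cabs a + 1))) (ltac:(by rewrite divr_gt0)).
have [B [fB hB]] := h' (e / 2) (ltac:(by rewrite divr_gt0)).
exists (A `|` B); split; first by rewrite finite_setU.
move=> D fD ABD.
have hD := hA _ fD (subset_trans (@subsetUl _ _ _) ABD).
have hD' := hB _ fD (subset_trans (@subsetUr _ _ _) ABD).
rewrite fsbig_split//= -mulr_fsumr.
rewrite (_ : _ - _ = a * (l - \sum_(x \in D) F x) + (l' - \sum_(x \in D) G x)).
  rewrite (le_lt_trans (cabsD _ _))// cabsM.
  have : cabs a * cabs (l - \sum_(x \in D) F x) <= e / 2.
    rewrite (@le_trans _ _ (cabs a * (e / (2 * (cabs a + 1)))))//.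
      by rewrite ler_wpM2l ?cabs_ge0// ltW.
    rewrite mulrA ler_pdivrMr// mulrA divfK ?pnatr_eq0//.
    have := cabs_ge0 a; nra.
  lra.
ring.
Qed.

Lemma hsum_nonneg f : summ f -> hsum (fun i => ofR (f i)) (ofR (rsum f)).
Proof.
move=> sf e e0; have [A fA hA] := rsum_approx sf e0; exists A; split=> //.
move=> B fB AB.
have -> : \sum_(x \in B) ofR (f x) = ofR (\sum_(x \in B) f x).
  rewrite !fsbig_finite//=; elim: (finmap.enum_fset _) => [|i s IH].
    by rewrite !big_nil.
  by rewrite !big_cons IH ofRD.
rewrite -ofRN -ofRD cabs_ofR ger0_norm ?subr_ge0 ?fsum_le_rsum//.
have [f0 _] := sf.
suff : \sum_(i \in A) f i <= \sum_(i \in B) f i by lra.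
rewrite -lee_fin -!fsumEFin//; apply: lee_fsum_nneg_subset => //.
- exact/subsetP.
- by move=> i _; rewrite lee_fin.
Qed.

Lemma absum_le F f : (forall i, cabs (F i) <= f i) -> summ f -> absum F.
Proof.
by move=> h sf; apply: (proj1 (summ_le _ sf)) => i; rewrite /= cabs_ge0 h.
Qed.

Lemma absum_lin a F G : absum F -> absum G -> absum (fun i => a * F i + G i).
Proof.
move=> sF sG; have [s1 _] := summZ (cabs_ge0 a) sF.
apply: absum_le (proj1 (summD s1 sG)) => i /=.
by rewrite (le_trans (cabsD _ _))// cabsM.
Qed.

Lemma absum0 : absum (fun _ : I => 0 : C).
Proof. by rewrite /absum /comp cabs0; exact: (proj1 (summ0 _ _)). Qed.

Lemma absum_nonneg f : summ f -> absum (fun i => ofR (f i)).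
Proof.
by move=> sf; apply: (absum_le _ sf) => i; rewrite cabs_ofR ger0_norm//; case: sf.
Qed.

(* Positive and negative parts of the real and imaginary parts reduce every
   linear statement on absolutely summable families to the non-negative case. *)
Lemma absum_ind (P : (I -> C) -> Prop) :
  (forall f, summ f -> P (fun i => ofR (f i))) ->
  (forall a F G, absum F -> absum G -> P F -> P G -> P (fun i => a * F i + G i)) ->
  forall F, absum F -> P F.
Proof.
move=> Pn Pl F sF.
pose rp i := Num.max (complex.Re (F i)) 0; pose rn i := Num.max (- complex.Re (F i)) 0.
pose ip i := Num.max (complex.Im (F i)) 0; pose im i := Num.max (- complex.Im (F i)) 0.
have sub (h : I -> R) : (forall i, `|h i| <= cabs (F i)) ->
    summ (fun i => Num.max (h i) 0).
  move=> hF; apply: (proj1 (summ_le _ sF)) => i /=.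
  rewrite le_max lexx orbT /= ge_max cabs_ge0 andbT.
  exact: le_trans (ler_norm _) (hF i).
have srp : summ rp by apply: sub => i; exact: cabs_Re.
have sip : summ ip by apply: sub => i; exact: cabs_Im.
have srn : summ rn by apply: sub => i; rewrite normrN; exact: cabs_Re.
have sim : summ im by apply: sub => i; rewrite normrN; exact: cabs_Im.
have maxB (x : R) : Num.max x 0 - Num.max (- x) 0 = x.
  by have [x0|x0] := leP x 0; [rewrite max_l|rewrite max_r]; lra.
pose i0 : C := (0 +i* 1)%C.
pose F1 i := - i0 * ofR (im i) + 0.
pose F2 i := i0 * ofR (ip i) + F1 i.
pose F3 i := -1 * ofR (rn i) + F2 i.
have a0 := absum0.
have P0 : P (fun _ => 0) by have := Pn _ (proj1 (summ0 R I)).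
have a1 : absum F1 by apply: absum_lin (absum_nonneg sim) a0.
have a2 : absum F2 by apply: absum_lin (absum_nonneg sip) a1.
have a3 : absum F3 by apply: absum_lin (absum_nonneg srn) a2.
have P1 : P F1 by apply: Pl (absum_nonneg sim) a0 (Pn _ sim) P0.
have P2 : P F2 by apply: Pl (absum_nonneg sip) a1 (Pn _ sip) P1.
have P3 : P F3 by apply: Pl (absum_nonneg srn) a2 (Pn _ srn) P2.
suff -> : F = (fun i => 1 * ofR (rp i) + F3 i).
  by apply: Pl (absum_nonneg srp) a3 (Pn _ srp) P3.
apply/funext => i; rewrite [LHS]complex_decomp /F3 /F2 /F1.
rewrite -{1}(maxB (complex.Re (F i))) -{1}(maxB (complex.Im (F i))).
rewrite !ofRD !ofRN -/(rp i) -/(rn i) -/(ip i) -/(im i) -/i0; ring.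
Qed.

Lemma absum_hsum F : absum F -> hsum F (csum F).
Proof.
move=> sF; suff [l h] : exists l, hsum F l by rewrite (hsum_csum h).
elim/absum_ind : F / sF => [f sf|a F G _ _ [l h] [l' h']].
- by exists (ofR (rsum f)); exact: hsum_nonneg.
- by exists (a * l + l'); exact: hsum_lin.
Qed.

Lemma csum_lin a F G : absum F -> absum G ->
  csum (fun i => a * F i + G i) = a * csum F + csum G.
Proof.
by move=> sF sG; apply: hsum_csum; apply: hsum_lin; exact: absum_hsum.
Qed.

Lemma csum_nonneg f : summ f -> csum (fun i => ofR (f i)) = ofR (rsum f).
Proof. by move=> sf; apply: hsum_csum; exact: hsum_nonneg. Qed.

Lemma csum0 : csum (fun _ : I => 0 : C) = 0.
Proof. by have [s e] := summ0 R I; have := csum_nonneg s; rewrite e. Qed.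

Lemma csumZ a F : absum F ->
  absum (fun i => a * F i) /\ csum (fun i => a * F i) = a * csum F.
Proof.
move=> sF; have := csum_lin a sF absum0; have := absum_lin a sF absum0.
by rewrite csum0 addr0; under eq_fun do rewrite addr0.
Qed.

Lemma csumD F G : absum F -> absum G ->
  absum (fun i => F i + G i) /\ csum (fun i => F i + G i) = csum F + csum G.
Proof.
move=> sF sG; have := csum_lin 1 sF sG; have := absum_lin 1 sF sG.
by rewrite mul1r; under eq_fun do rewrite mul1r.
Qed.

Lemma cabs_csum F : absum F -> cabs (csum F) <= rsum (@cabs R \o F).
Proof.
move=> sF; apply/ler_addgt0Pr => e e0.
have [A [fA /(_ A fA (@subset_refl _ _)) hA]] := absum_hsum sF e0.
have := fsum_le_rsum sF fA; rewrite fsbig_finite//= => hA'.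
move: hA; rewrite fsbig_finite//= => hA.
have := cabs_sum (finmap.enum_fset (fset_set A)) F.
have := cabsD (csum F - \sum_(i <- finmap.enum_fset (fset_set A)) F i)
  (\sum_(i <- finmap.enum_fset (fset_set A)) F i).
rewrite subrK; lra.
Qed.

Lemma csum_finite (s : seq I) F : uniq s -> (forall i, i \notin s -> F i = 0) ->
  absum F /\ csum F = \sum_(i <- s) F i.
Proof.
move=> us F0.
have fs : finite_set [set` s] by exact: finite_seq.
have sumE (V : nmodType) (g : I -> V) B : (forall i, i \notin s -> g i = 0) ->
    finite_set B -> [set` s] `<=` B -> \sum_(i \in B) g i = \sum_(i <- s) g i.
  move=> g0 fB sB; rewrite (fsbig_seq _ _ us).
  apply/esym/fsbig_widen => // i [_ /= /negP]; exact: g0.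
split.
  apply: (proj1 (@summ_bound _ _ _ (\sum_(i <- s) cabs (F i)) _ _)).
    by move=> i; exact: cabs_ge0.
  move=> A fA; rewrite -(sumE _ (@cabs R \o F) (A `|` [set` s])).
  - rewrite -lee_fin -!fsumEFin// ?finite_setU//.
    apply: lee_fsum_nneg_subset => //; rewrite ?finite_setU//.
    + exact/subsetP/subsetUl.
    + by move=> i _; rewrite lee_fin /= cabs_ge0.
  - by move=> i /F0 /= ->; rewrite cabs0.
  - by rewrite finite_setU.
  - exact: subsetUr.
apply: hsum_csum => e e0; exists [set` s]; split=> // B fB sB.
by rewrite sumE// subrr cabs0.
Qed.

End OneIndex.

Lemma absum_inj (I J : choiceType) (e : I -> J) (F : J -> C) :
  injective e -> (forall j, (forall i, e i <> j) -> F j = 0) ->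
  (absum F <-> absum (F \o e)).
Proof.
move=> ei F0; apply: (proj1 (summ_inj ei _)) => j /F0 /= ->.
exact: cabs0.
Qed.

Definition ext0 (I J : choiceType) (e : I -> J) (F : I -> C) : J -> C :=
  fun j => xget 0 [set z | exists2 i, e i = j & z = F i].

Lemma ext0_in (I J : choiceType) (e : I -> J) F i : injective e ->
  ext0 e F (e i) = F i.
Proof.
move=> ei; rewrite /ext0; case: xgetP => [z -> [i' /ei -> //]|/(_ (F i))[]].
by exists i.
Qed.

Lemma ext0_out (I J : choiceType) (e : I -> J) F j : (forall i, e i <> j) ->
  ext0 e F j = 0.
Proof.
by move=> h; rewrite /ext0; case: xgetP => // z -> [i /h].
Qed.

(** Stated for an extension by zero and not for a family vanishing off the image of [e]: in the
    linear step of [absum_ind] a combination may vanish where its two terms do not. *)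
Lemma csum_ext0 (I J : choiceType) (e : I -> J) (F : I -> C) : injective e ->
  absum F -> csum (ext0 e F) = csum F.
Proof.
move=> ei sF.
have absext H : absum H -> absum (ext0 e H).
  move=> sH; apply/(absum_inj ei); first by move=> j; exact: ext0_out.
  by rewrite (_ : _ \o _ = H)//; apply/funext => i /=; rewrite ext0_in.
elim/absum_ind : F / sF => [f sf|a F G sF sG hF hG].
  pose g j := complex.Re (ext0 e (fun i => ofR (f i)) j).
  have gE j : ext0 e (fun i => ofR (f i)) j = ofR (g j).
    rewrite /g; have [[i <-]|/forallNP h] := pselect (exists i, e i = j).
      by rewrite ext0_in.
    by rewrite ext0_out.
  have ge : g \o e = f by apply/funext => i; rewrite /g /= ext0_in.
  have g0 j : (forall i, e i <> j) -> g j = 0 by move=> h; rewrite /g ext0_out.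
  have [h1 h2] := summ_inj ei g0; rewrite ge in h1 h2.
  by rewrite (funext gE) csum_nonneg ?csum_nonneg ?h2// h1.
rewrite (_ : ext0 e _ = (fun j => a * ext0 e F j + ext0 e G j)).
  rewrite !csum_lin ?hF ?hG//; exact: absext.
apply/funext => j; have [[i <-]|/forallNP h] := pselect (exists i, e i = j).
  by rewrite !ext0_in.
by rewrite !ext0_out// mulr0 addr0.
Qed.

Lemma csum_inj (I J : choiceType) (e : I -> J) (F : J -> C) :
  injective e -> (forall j, (forall i, e i <> j) -> F j = 0) ->
  absum F -> csum F = csum (F \o e).
Proof.
move=> ei F0 /(absum_inj ei F0) sF; rewrite -(csum_ext0 ei sF); congr csum.
apply/funext => j; have [[i <-]|/forallNP h] := pselect (exists i, e i = j).
  by rewrite !ext0_in.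
by rewrite ext0_out// F0.
Qed.

Lemma csum_bij (I J : choiceType) (e : I -> J) (F : J -> C) :
  bijective e -> absum F -> absum (F \o e) /\ csum F = csum (F \o e).
Proof.
move=> be sF; have ei := bij_inj be.
have F0 j : (forall i, e i <> j) -> F j = 0.
  by case: be => e' _ e'K /(_ (e' j)); rewrite e'K.
by split; [exact/(absum_inj ei F0)|exact: csum_inj].
Qed.

(** The conclusions are stable under linear combinations, so [absum_ind] reduces Fubini to the
    non-negative case [summ_pair]. *)
Lemma csum_pair (I J : choiceType) (F : I * J -> C) : absum F ->
  [/\ forall i, absum (fun j => F (i, j)),
      absum (fun i => csum (fun j => F (i, j))) &
      csum F = csum (fun i => csum (fun j => F (i, j)))].
Proof.
elim/absum_ind => {F} [f sf|a F G sF sG [F1 F2 F3] [G1 G2 G3]].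
  have [s1 s2 E] := summ_pair sf.
  have E1 : (fun i => csum (fun j => ofR (f (i, j)))) =
            (fun i => ofR (rsum (fun j => f (i, j)))).
    by apply/funext => i; rewrite csum_nonneg.
  split; rewrite ?E1 ?csum_nonneg ?E//.
  - by move=> i; exact: absum_nonneg.
  - exact: absum_nonneg.
have E1 : (fun i => csum (fun j => a * F (i, j) + G (i, j))) =
          (fun i => a * csum (fun j => F (i, j)) + csum (fun j => G (i, j))).
  by apply/funext => i; rewrite csum_lin.
split; rewrite ?E1.
- by move=> i; exact: absum_lin.
- exact: absum_lin.
- by rewrite !csum_lin// F3 G3.
Qed.

Lemma pair_absum (I J : choiceType) (F : I * J -> C) (b : I -> R) :
  (forall i, absum (fun j => F (i, j))) ->
  (forall i, rsum (fun j => cabs (F (i, j))) <= b i) -> summ b -> absum F.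
Proof.
move=> s1 Fb sb; apply: pair_summ => //=.
by apply: (proj1 (summ_le _ sb)) => i; rewrite Fb rsum_ge0// => j; exact: cabs_ge0.
Qed.

Lemma csum_prod (I J : choiceType) (F : I -> C) (G : J -> C) :
  absum F -> absum G ->
  absum (fun k : I * J => F k.1 * G k.2) /\
  csum (fun k : I * J => F k.1 * G k.2) = csum F * csum G.
Proof.
move=> sF sG.
have s : absum (fun k : I * J => F k.1 * G k.2).
  apply: (@pair_absum _ _ _ (fun i => cabs (F i) * rsum (@cabs R \o G))) => /=.
  - by move=> i; exact: (proj1 (csumZ _ sG)).
  - move=> i; rewrite -(proj2 (summZ (cabs_ge0 _) sG)) /comp.
    by under eq_fun do rewrite cabsM.
  - have := proj1 (summZ (rsum_ge0 (fun j => cabs_ge0 (G j))) sF).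
    by under eq_fun do rewrite mulrC.
split=> //; have [_ _ ->] := csum_pair s => /=.
under eq_fun do rewrite (proj2 (csumZ _ sG)) mulrC.
by rewrite (proj2 (csumZ _ sF)) mulrC.
Qed.

Lemma csum_nat (F : nat -> C) : absum F ->
  (fun n => \sum_(0 <= i < n) F i) @ \oo --> csum F.
Proof.
move=> sF; apply/cvg_cabsP => e e0.
have [A [fA hA]] := absum_hsum sF e0.
have [N hN] : exists N, A `<=` `I_N.
  have /finite_fsetP[B ->] := fA.
  exists (\max_(i <- finmap.enum_fset B) i).+1 => i /= iB; rewrite ltnS.
  exact: (@leq_bigmax_seq _ _ xpredT id i iB).
exists N => n Nn.
have := hA `I_n (finite_II n); rewrite -fsbig_ord big_mkord; apply.
by move=> i /hN /= h; exact: leq_trans h Nn.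
Qed.

Lemma summ_finite (I : choiceType) (s : seq I) (f : I -> R) : uniq s ->
  (forall i, 0 <= f i) -> (forall i, i \notin s -> f i = 0) ->
  summ f /\ rsum f = \sum_(i <- s) f i.
Proof.
move=> us f0 fs.
have [sF E] := @csum_finite I s (fun i => ofR (f i)) us
  (fun i h => f_equal (@ofR R) (fs i h)).
have sf : summ f.
  by move: sF; rewrite /absum /comp; under eq_fun do rewrite cabs_ofR ger0_norm//.
split=> //; apply: ofR_inj; rewrite -csum_nonneg// E.
by elim: (s) => [|i t IH]; rewrite ?big_nil ?big_cons ?ofRD ?IH.
Qed.

Lemma summ_prod (I J : choiceType) (f : I -> R) (g : J -> R) :
  summ f -> summ g ->
  summ (fun k : I * J => f k.1 * g k.2) /\
  rsum (fun k : I * J => f k.1 * g k.2) = rsum f * rsum g.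
Proof.
move=> sf sg; have [f0 _] := sf; have [g0 _] := sg.
have [sF E] := csum_prod (absum_nonneg sf) (absum_nonneg sg).
have s : summ (fun k : I * J => f k.1 * g k.2).
  move: sF; rewrite /absum /comp.
  by under eq_fun do rewrite -ofRM cabs_ofR ger0_norm ?mulr_ge0//.
split=> //; apply: ofR_inj; rewrite ofRM -!csum_nonneg// -E.
by under eq_fun do rewrite ofRM.
Qed.

Lemma cvgC_uniq (a : nat -> C) (l l' : C) : a @ \oo --> l -> a @ \oo --> l' -> l = l'.
Proof.
move=> /cvg_cabsP h /cvg_cabsP h'; apply: cabs_small_eq => e e0.
have [N hN] := h (e / 2) (ltac:(by rewrite divr_gt0)).
have [M hM] := h' (e / 2) (ltac:(by rewrite divr_gt0)).
have := hN _ (leq_maxl N M); have := hM _ (leq_maxr N M).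
have := cabs_triangle l (a (maxn N M)) l'.
rewrite (cabs_distC (a _) l'); lra.
Qed.

End ComplexSums.

(** * Hölder's inequality and the spaces lp(G) *)

HB.lock Definition nrm (R : realType) (G : groupType) (r : R) (f : G -> Cx R) : R :=
  lp_norm r f.

Section Lp.
Variables (R : realType) (G : groupType).
Local Notation C := (Cx R).

Lemma conj_exp_gt1 (p : R) : 1 < p -> 1 < conj_exp p.
Proof.
move=> p1; rewrite /conj_exp ltr_pdivlMr ?subr_gt0// mul1r; lra.
Qed.

Lemma conj_expV (p : R) : 1 < p -> p^-1 + (conj_exp p)^-1 = 1.
Proof.
move=> p1; have p0 : p != 0 by lra.
by rewrite /conj_exp invf_div; field.
Qed.

Lemma powR_invK (r s : R) : 0 <= r -> s != 0 -> (r `^ s^-1) `^ s = r.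
Proof. by move=> r0 s0; rewrite -powRrM mulVf// powRr1. Qed.

Lemma powR_Kinv (r s : R) : 0 <= r -> s != 0 -> (r `^ s) `^ s^-1 = r.
Proof. by move=> r0 s0; rewrite -powRrM mulfV// powRr1. Qed.

Lemma hoelder_rsum (I : choiceType) (p q : R) (f g : I -> R) :
  0 < p -> 0 < q -> p^-1 + q^-1 = 1 ->
  (forall i, 0 <= f i) -> (forall i, 0 <= g i) ->
  summ (fun i => f i `^ p) -> summ (fun i => g i `^ q) ->
  summ (fun i => f i * g i) /\
  rsum (fun i => f i * g i) <=
    rsum (fun i => f i `^ p) `^ p^-1 * rsum (fun i => g i `^ q) `^ q^-1.
Proof.
move=> p0 q0 pq f0 g0 sf sg.
set A := rsum (fun i => f i `^ p); set B := rsum (fun i => g i `^ q).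
have A0 : 0 <= A by apply: rsum_ge0 => i; exact: powR_ge0.
have B0 : 0 <= B by apply: rsum_ge0 => i; exact: powR_ge0.
have zero (h : I -> R) (r : R) : 0 < r -> (forall i, 0 <= h i) ->
    summ (fun i => h i `^ r) -> rsum (fun i => h i `^ r) = 0 -> forall i, h i = 0.
  move=> r0 h0 sh E i; have := le_rsum1 i sh; rewrite E => h1.
  apply/eqP; have : h i `^ r == 0 by rewrite eq_le h1 powR_ge0.
  by rewrite powR_eq0 => /andP[].
have [EA|An0] := eqVneq A 0.
  rewrite (_ : (fun i => f i * g i) = fun=> 0).
    by have [? ->] := summ0 R I; rewrite mulr_ge0 ?powR_ge0.
  by apply/funext => i; rewrite (zero f p)// mul0r.
have [EB|Bn0] := eqVneq B 0.
  rewrite (_ : (fun i => f i * g i) = fun=> 0).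
    by have [? ->] := summ0 R I; rewrite mulr_ge0 ?powR_ge0.
  by apply/funext => i; rewrite (zero g q)// mulr0.
have Ap : 0 < A by rewrite lt_def An0.
have Bp : 0 < B by rewrite lt_def Bn0.
set a := A `^ p^-1; set b := B `^ q^-1.
have a0 : 0 < a by exact: powR_gt0.
have b0 : 0 < b by exact: powR_gt0.
have aV : (a^-1) `^ p = A^-1.
  by rewrite /a -powRN -powRrM mulNr mulVf ?gt_eqF// powR_inv1// ltW.
have bV : (b^-1) `^ q = B^-1.
  by rewrite /b -powRN -powRrM mulNr mulVf ?gt_eqF// powR_inv1// ltW.
have eA : rsum (fun i => f i `^ p) = A by [].
have eB : rsum (fun i => g i `^ q) = B by [].
clearbody a b A B.
(* Coefficients of Young's inequality for [f i / a] and [g i / b] after multiplication by [a * b].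
   Summed over [i] they contribute [a * b / p] and [a * b / q]. *)
pose ca := a * b / (A * p); pose cb := a * b / (B * q).
have ca0 : 0 <= ca by apply: divr_ge0; apply: mulr_ge0; apply: ltW.
have cb0 : 0 <= cb by apply: divr_ge0; apply: mulr_ge0; apply: ltW.
have [s1 e1] := summZ ca0 sf.
have [s2 e2] := summZ cb0 sg.
have [s3 e3] := summD s1 s2.
have le i : 0 <= f i * g i <= ca * f i `^ p + cb * g i `^ q.
  rewrite mulr_ge0//=.
  have := @conjugate_powR R (f i / a) (g i / b) p q
    (ltac:(by rewrite divr_ge0// ltW)) (ltac:(by rewrite divr_ge0// ltW)) p0 q0 pq.
  have -> : (f i / a) `^ p = f i `^ p * A^-1.
    by rewrite powRM ?aV ?invr_ge0 ?(ltW a0).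
  have -> : (g i / b) `^ q = g i `^ q * B^-1.
    by rewrite powRM ?bV ?invr_ge0 ?(ltW b0).
  rewrite -(@ler_pM2l _ (a * b)) ?mulr_gt0//.
  have -> : a * b * (f i / a * (g i / b)) = f i * g i.
    by field; rewrite !gt_eqF.
  have -> // : a * b * (f i `^ p / A / p + g i `^ q / B / q) =
            ca * f i `^ p + cb * g i `^ q.
  by rewrite /ca /cb; field; rewrite !gt_eqF.
have [s4 h4] := summ_le le s3; split=> //.
rewrite (le_trans h4)// e3 e1 e2 eA eB /ca /cb.
have -> : a * b / (A * p) * A + a * b / (B * q) * B = a * b * (p^-1 + q^-1).
  by field; rewrite !gt_eqF.
by rewrite pq mulr1.
Qed.

Implicit Types (f g h k u v : G -> C).

Lemma in_lpP (r : R) f : in_lp r f <-> summ (fun x => cabs (f x) `^ r).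
Proof.
rewrite /in_lp /lp_sum -esumT_def.
by split=> [h|[]//]; split=> // x; exact: powR_ge0.
Qed.

Lemma nrmE (r : R) f : nrm r f = lp_norm r f.
Proof. by rewrite nrm.unlock. Qed.

Lemma nrm_rsum (r : R) f : nrm r f = rsum (fun x => cabs (f x) `^ r) `^ r^-1.
Proof. by rewrite nrmE rsum_def esumT_def. Qed.

Lemma nrm_ge0 (r : R) f : 0 <= nrm r f.
Proof. by rewrite nrm_rsum powR_ge0. Qed.

Lemma nrm_pow (r : R) f : 0 < r ->
  nrm r f `^ r = rsum (fun x => cabs (f x) `^ r).
Proof.
move=> r0; rewrite nrm_rsum powR_invK ?gt_eqF//.
by apply: rsum_ge0 => x; exact: powR_ge0.
Qed.

Lemma lp_zero (r : R) : 0 < r ->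
  in_lp r (fun _ : G => 0 : C) /\ nrm r (fun _ : G => 0 : C) = 0.
Proof.
move=> r0; have E : (fun _ : G => cabs (0 : C) `^ r) = fun=> 0.
  by apply/funext => x; rewrite cabs0 powR0// gt_eqF.
have [s e] := summ0 R G.
by split; [apply/in_lpP|rewrite nrm_rsum]; rewrite E// e powR0// invr_neq0// gt_eqF.
Qed.

Lemma lp_scale (r : R) (a : C) f : 0 < r -> in_lp r f ->
  in_lp r (fun x => a * f x) /\ nrm r (fun x => a * f x) = cabs a * nrm r f.
Proof.
move=> r0 /in_lpP sf.
have E : (fun x => cabs (a * f x) `^ r) = (fun x => cabs a `^ r * cabs (f x) `^ r).
  by apply/funext => x; rewrite cabsM powRM ?cabs_ge0.
have [s e] := summZ (powR_ge0 (cabs a) r) sf.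
split; first by apply/in_lpP; rewrite E.
rewrite !nrm_rsum E e powRM ?powR_ge0//.
  by rewrite powR_Kinv ?cabs_ge0// gt_eqF.
by apply: rsum_ge0 => x; exact: powR_ge0.
Qed.

Lemma lp_le (r : R) f g : 0 < r -> (forall x, cabs (f x) <= cabs (g x)) ->
  in_lp r g -> in_lp r f /\ nrm r f <= nrm r g.
Proof.
move=> r0 fg /in_lpP sg.
have [|s e] := @summ_le _ _ (fun x => cabs (f x) `^ r) _ _ sg.
  move=> x; rewrite powR_ge0/= ge0_ler_powR ?nnegrE ?cabs_ge0// ltW//.
split; first exact/in_lpP.
rewrite !nrm_rsum ge0_ler_powR ?nnegrE ?invr_ge0 ?(ltW r0)//.
  by apply: rsum_ge0 => x; exact: powR_ge0.
by apply: rsum_ge0 => x; exact: powR_ge0.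
Qed.

Lemma lp_tail (r e : R) f : 0 < r -> in_lp r f -> 0 < e ->
  exists2 A : set G, finite_set A &
    nrm r (fun x => if x \in A then 0 else f x) < e.
Proof.
move=> r0 /in_lpP sf e0.
have [A fA hA] := rsum_tail sf (powR_gt0 r e0).
exists A => //; rewrite nrm_rsum.
rewrite (_ : (fun x => _) = fun x => if x \in A then 0 else cabs (f x) `^ r).
  rewrite -(@powR_Kinv e r) ?gt_eqF ?ltW//.
  rewrite gt0_ltr_powR ?invr_gt0 ?nnegrE ?powR_ge0//.
  by apply: rsum_ge0 => x; case: ifP => // _; exact: powR_ge0.
by apply/funext => x; case: ifP => // _; rewrite cabs0 powR0// gt_eqF.
Qed.

Lemma translate_bij (x : G) : bijective (fun y => (x * y)%g).
Proof. by exists (fun y => (x^-1 * y)%g) => y; rewrite mulgA ?mulVg ?mulgV mul1g. Qed.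

Lemma lp_translate (r : R) f (x : G) : in_lp r f ->
  in_lp r (fun y => f (x * y)%g) /\ nrm r (fun y => f (x * y)%g) = nrm r f.
Proof.
move=> /in_lpP sf.
have [h1 h2] := @summ_bij R G G _ (fun y => cabs (f y) `^ r) (translate_bij x).
by split; [apply/in_lpP/h1|rewrite !nrm_rsum h2].
Qed.

Lemma convE g f x : Defs.conv g (check f) x = csum (fun y => g y * f (x^-1 * y)%g).
Proof.
rewrite (_ : csum _ = sumG (fun y => g y * f (x^-1 * y)%g)); last first.
  by rewrite csum.unlock.
rewrite /Defs.conv; congr sumG; apply/funext => y.
by rewrite /check invgM invgK.
Qed.

(** The substitution z = y t separates the double sum over [t] and [y] into the sum for [f] times
    the sum for [h]. Used with both exponents, it provides the two families in [t] to which Hölder's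
    inequality is applied in [Apn_mul]. *)
Lemma lp_shift_mul (r : R) f h : 0 < r -> in_lp r f -> in_lp r h ->
  [/\ forall t, in_lp r (fun y => f y * h (y * t)%g),
      summ (fun t => nrm r (fun y => f y * h (y * t)%g) `^ r) &
      rsum (fun t => nrm r (fun y => f y * h (y * t)%g) `^ r)
      = (nrm r f * nrm r h) `^ r].
Proof.
move=> r0 /in_lpP sf /in_lpP sh.
have [s e] := summ_prod sf sh.
have be : bijective (fun k : G * G => (k.2, k.2 * k.1)%g).
  exists (fun k : G * G => (k.1^-1 * k.2, k.1)%g) => -[x y] /=.
    by rewrite mulgA mulVg mul1g.
  by rewrite mulgA mulgV mul1g.
have [h1 h2] := @summ_bij R _ _ _ (fun k : G * G => cabs (f k.1) `^ r * cabs (h k.2) `^ r) be.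
have E : (fun k : G * G => cabs (f k.1) `^ r * cabs (h k.2) `^ r) \o
    (fun k : G * G => (k.2, k.2 * k.1)%g) =
    (fun k : G * G => cabs (f k.2 * h (k.2 * k.1)%g) `^ r).
  by apply/funext => k /=; rewrite cabsM powRM ?cabs_ge0.
rewrite E in h1 h2.
have [t1 t2 t3] := summ_pair (h1.1 s); rewrite /= in t1 t2 t3.
have E2 t : nrm r (fun y => f y * h (y * t)%g) `^ r =
    rsum (fun y => cabs (f y * h (y * t)%g) `^ r) by rewrite nrm_pow.
split.
- by move=> t; exact/in_lpP.
- by under eq_fun do rewrite E2.
- under eq_fun do rewrite E2.
  rewrite (powRM _ (nrm_ge0 r f) (nrm_ge0 r h)).
  rewrite -(nrm_pow f r0) -(nrm_pow h r0) in e.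
  exact: etrans (esym t3) (etrans (esym h2) e).
Qed.

Variables p q : R.
Hypotheses (p0 : 0 < p) (q0 : 0 < q) (pq : p^-1 + q^-1 = 1).

Lemma lp_pairing f g : in_lp p f -> in_lp q g ->
  absum (fun y => g y * f y) /\
  rsum (fun y => cabs (g y * f y)) <= nrm p f * nrm q g.
Proof.
move=> /in_lpP sf /in_lpP sg.
have [s h] := hoelder_rsum p0 q0 pq (fun x => cabs_ge0 (f x))
  (fun x => cabs_ge0 (g x)) sf sg.
have E : (fun y => cabs (g y * f y)) = (fun y => cabs (f y) * cabs (g y)).
  by apply/funext => y; rewrite cabsM mulrC.
by rewrite /absum /comp E !nrm_rsum.
Qed.

Lemma kernel_summ f g x : in_lp p f -> in_lp q g ->
  absum (fun y => g y * f (x^-1 * y)%g) /\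
  rsum (fun y => cabs (g y * f (x^-1 * y)%g)) <= nrm p f * nrm q g.
Proof.
move=> sf sg; have [s e] := lp_translate x^-1%g sf.
by rewrite -e; exact: (lp_pairing s sg).
Qed.

End Lp.

(** * The algebra Ap(G) *)

Section HerzAlgebra.
Variables (R : realType) (G : groupType) (p : R).
Variable q : R.
Hypotheses (p0 : 0 < p) (q0 : 0 < q) (pq : p^-1 + q^-1 = 1).
Local Notation C := (Cx R).

Implicit Types (u v : G -> C).

Definition weight (I : choiceType) (f g : I -> G -> C) (i : I) : R :=
  nrm p (f i) * nrm q (g i).

Lemma weight_ge0 (I : choiceType) (f g : I -> G -> C) i : 0 <= weight f g i.
Proof. by rewrite mulr_ge0 ?nrm_ge0. Qed.

(* Representations indexed by an arbitrary countable type, with the sum over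
   the index and the convolution sum merged into a single unordered sum. *)
Definition herz_rep (I : choiceType) u (f g : I -> G -> C) : Prop :=
  [/\ forall i, in_lp p (f i), forall i, in_lp q (g i), summ (weight f g) &
      forall x, u x = csum (fun k : I * G => g k.1 k.2 * f k.1 (x^-1 * k.2)%g)].

Lemma herz_kernel_absum (I : choiceType) (f g : I -> G -> C) x :
  (forall i, in_lp p (f i)) -> (forall i, in_lp q (g i)) -> summ (weight f g) ->
  absum (fun k : I * G => g k.1 k.2 * f k.1 (x^-1 * k.2)%g).
Proof.
move=> hf hg sw; apply: (pair_absum _ _ sw) => i /=.
- exact: (proj1 (kernel_summ p0 q0 pq x (hf i) (hg i))).
- exact: (proj2 (kernel_summ p0 q0 pq x (hf i) (hg i))).
Qed.

Lemma herz_rep_conv (I : choiceType) u (f g : I -> G -> C) : herz_rep u f g ->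
  forall x, absum (fun i => Defs.conv (g i) (check (f i)) x) /\
            u x = csum (fun i => Defs.conv (g i) (check (f i)) x).
Proof.
move=> [hf hg sw hu] x; have := herz_kernel_absum x hf hg sw.
move=> /csum_pair[_ h1 h2]; rewrite hu h2; under eq_fun do rewrite convE.
by split.
Qed.

Lemma esumT_weight (f g : nat -> G -> C) :
  esumT (weight f g) = (\esum_(i in [set: nat]) (lp_norm p (f i) * lp_norm q (g i))%:E).
Proof. by rewrite esumT_def; apply: eq_esum => i _; rewrite /weight !nrmE. Qed.

(** Finite total weight makes the family over [nat * G] absolutely summable at each point; Fubini
    and uniqueness of limits identify its sum with the limit of the partial sums. *)
Lemma Ap_repE u (f g : nat -> G -> C) : q = conj_exp p ->
  Ap_rep p u f g <-> herz_rep u f g.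
Proof.
move=> qE; rewrite /Ap_rep -qE -esumT_weight.
split=> [[hf hg sw hu]|[hf hg sw hu]]; last first.
  split; [exact: hf|exact: hg|by case: sw|move=> x].
  have [s ->] := herz_rep_conv (And4 hf hg sw hu) x.
  exact: csum_nat.
have sw' : summ (weight f g) by split=> // i; exact: weight_ge0.
pose u' x := csum (fun k : nat * G => g k.1 k.2 * f k.1 (x^-1 * k.2)%g).
have h : herz_rep u' f g by [].
split; [exact: hf|exact: hg|exact: sw'|move=> x; rewrite -/(u' x)].
have [s E] := herz_rep_conv h x.
by apply: cvgC_uniq (hu x) _; rewrite E; exact: csum_nat.
Qed.

(** Membership together with norm less than [r]. The infimum in the norm need not be attained,
    whereas strict bounds come with an actual representation and can be combined directly. *)
Definition Apn u (r : R) : Prop :=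
  exists f g : nat -> G -> C, herz_rep u f g /\ rsum (weight f g) < r.

Lemma Apn_rep (I : choiceType) u (f g : I -> G -> C) r :
  countable [set: I] -> herz_rep u f g -> rsum (weight f g) < r -> Apn u r.
Proof.
move=> /countable_injP[e ei] [hf hg sw hu] wr.
have {}ei : injective e by move=> x y; apply: ei; rewrite inE.
pose f' n y := ext0 e (fun i => f i y) n; pose g' n y := ext0 e (fun i => g i y) n.
have f'e i : f' (e i) = f i by apply/funext => y; rewrite /f' ext0_in.
have g'e i : g' (e i) = g i by apply/funext => y; rewrite /g' ext0_in.
have f'0 n : (forall i, e i <> n) -> f' n = fun=> 0.
  by move=> h; apply/funext => y; rewrite /f' ext0_out.
have g'0 n : (forall i, e i <> n) -> g' n = fun=> 0.
  by move=> h; apply/funext => y; rewrite /g' ext0_out.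
have w0 n : (forall i, e i <> n) -> weight f' g' n = 0.
  by move=> h; rewrite /weight (f'0 _ h) (proj2 (lp_zero _ p0)) mul0r.
have we : weight f' g' \o e = weight f g.
  by apply/funext => i; rewrite /weight /= f'e g'e.
have [h1 h2] := summ_inj ei w0; rewrite we in h1 h2.
have hf' n : in_lp p (f' n).
  have [[i <-]|/forallNP h] := pselect (exists i, e i = n); first by rewrite f'e.
  by rewrite (f'0 _ h); exact: (proj1 (lp_zero _ p0)).
have hg' n : in_lp q (g' n).
  have [[i <-]|/forallNP h] := pselect (exists i, e i = n); first by rewrite g'e.
  by rewrite (g'0 _ h); exact: (proj1 (lp_zero _ q0)).
exists f', g'; rewrite h2; split; last exact: wr.
split; [exact: hf'|exact: hg'|exact/h1|move=> x; rewrite hu].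
pose e2 (k : I * G) := (e k.1, k.2).
have e2i : injective e2 by move=> [i y] [j z] [/ei -> ->].
rewrite (csum_inj e2i).
- by congr csum; apply/funext => -[i y] /=; rewrite f'e g'e.
- move=> [n y] h /=.
  have hn i : e i <> n by move=> ein; apply: (h (i, y)); rewrite /e2 /= ein.
  by rewrite (f'0 n hn) mulr0.
- by apply: herz_kernel_absum => //; exact/h1.
Qed.

Lemma countable_prod (I J : choiceType) : countable [set: I] -> countable [set: J] ->
  countable [set: I * J].
Proof. by move=> cI cJ; rewrite -setXTT; exact: countableX. Qed.

Lemma Apn_add u v r s : Apn u r -> Apn v s -> Apn (fun x => u x + v x) (r + s).
Proof.
move=> [f [g [[hf hg sw hu] wr]]] [f' [g' [[hf' hg' sw' hv] ws]]].
(* [bool * nat] is the disjoint union of the two index sets. *)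
pose F (k : bool * nat) := if k.1 then f k.2 else f' k.2.
pose K (k : bool * nat) := if k.1 then g k.2 else g' k.2.
have hF k : in_lp p (F k) by rewrite /F; case: k.1.
have hK k : in_lp q (K k) by rewrite /K; case: k.1.
have us : uniq [:: true; false] by [].
have ns b : b \notin [:: true; false] -> False by case: b.
have s1 b : summ (fun i => weight F K (b, i)).
  by case: b; [exact: sw|exact: sw'].
have [s2 e2] : summ (fun b => rsum (fun i => weight F K (b, i))) /\
  rsum (fun b => rsum (fun i => weight F K (b, i))) =
  rsum (weight f g) + rsum (weight f' g').
  have [|b /ns//|s3 ->] := summ_finite us (f := fun b => rsum (fun i => weight F K (b, i))).
    by move=> b; apply: rsum_ge0 => i; exact: weight_ge0.
  by split=> //; rewrite !big_cons big_nil addr0.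
have sW := pair_summ s1 s2.
have [_ _ eW] := summ_pair sW.
apply: (@Apn_rep _ _ F K).
- exact: countableP.
- split; [exact: hF|exact: hK|exact: sW|move=> x].
  have := herz_kernel_absum x hF hK sW.
  pose e (k : bool * (nat * G)) := ((k.1, k.2.1), k.2.2).
  have be : bijective e.
    by exists (fun k => (k.1.1, (k.1.2, k.2))) => [[b [n y]]|[[b n] y]].
  move=> sA; have [sB ->] := csum_bij be sA.
  have [_ _ ->] := csum_pair sB.
  have [b /ns//|_ ->] := csum_finite us
    (F := fun b => csum (fun j : nat * G => K (b, j.1) j.2 * F (b, j.1) (x^-1 * j.2)%g)).
  by rewrite !big_cons big_nil addr0 hu hv.
- by rewrite eW e2 ltrD.
Qed.

Lemma Apn_scale u r s (a : C) : Apn u r -> cabs a * r < s ->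
  Apn (fun x => a * u x) s.
Proof.
move=> [f [g [[hf hg sw hu] wr]]] ars.
pose K i y := a * g i y.
have hK i : in_lp q (K i) by exact: (proj1 (lp_scale _ q0 (hg i))).
have W : weight f K = fun i => cabs a * weight f g i.
  by apply/funext => i; rewrite /weight (proj2 (lp_scale _ q0 (hg i))) mulrCA.
have [s1 e1] := summZ (cabs_ge0 a) sw.
exists f, K; split; last first.
  by rewrite W e1 (le_lt_trans _ ars)// ler_wpM2l ?cabs_ge0// ltW.
split; [exact: hf|exact: hK|by rewrite W|].
move=> x; rewrite hu -(proj2 (csumZ a (herz_kernel_absum x hf hg sw))).
by congr csum; apply/funext => k; rewrite mulrA.
Qed.

Lemma Apn_mul u v r s : countable [set: G] ->
  Apn u r -> Apn v s -> Apn (pmul u v) (r * s).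
Proof.
move=> cG [f [g [[hf hg sw hu] wr]]] [f' [g' [[hf' hg' sw' hv] ws]]].
pose F (k : nat * nat * G) y := f k.1.1 y * f' k.1.2 (y * k.2)%g.
pose K (k : nat * nat * G) y := g k.1.1 y * g' k.1.2 (y * k.2)%g.
have hF k : in_lp p (F k).
  by have [h _ _] := lp_shift_mul p0 (hf k.1.1) (hf' k.1.2); exact: h.
have hK k : in_lp q (K k).
  by have [h _ _] := lp_shift_mul q0 (hg k.1.1) (hg' k.1.2); exact: h.
have inner ij : summ (fun t => weight F K (ij, t)) /\
    rsum (fun t => weight F K (ij, t)) <= weight f g ij.1 * weight f' g' ij.2.
  have [_ a1 a2] := lp_shift_mul p0 (hf ij.1) (hf' ij.2).
  have [_ b1 b2] := lp_shift_mul q0 (hg ij.1) (hg' ij.2).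
  have [s1 h1] := hoelder_rsum p0 q0 pq
    (fun t => nrm_ge0 _ _) (fun t => nrm_ge0 _ _) a1 b1.
  split=> //; rewrite (le_trans h1)// a2 b2 !powR_Kinv ?gt_eqF// ?mulr_ge0 ?nrm_ge0//.
  by rewrite /weight mulrACA.
have [sP eP] := summ_prod sw sw'.
have outer ij : 0 <= rsum (fun t => weight F K (ij, t)) <=
    weight f g ij.1 * weight f' g' ij.2.
  apply/andP; split; last exact: (proj2 (inner ij)).
  by apply: rsum_ge0 => t; exact: weight_ge0.
have [sO hO] := summ_le outer sP.
have sW := pair_summ (fun ij => proj1 (inner ij)) sO.
have [_ _ eW] := summ_pair sW.
apply: (@Apn_rep _ _ F K).
- by apply: countable_prod => //; exact: countableP.
(* The bullet before this one is where countability of [G] enters: [G] is a factor of the index set.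
   What follows identifies the value at [x]. *)
- split; [exact: hF|exact: hK|exact: sW|move=> x; rewrite /pmul hu hv].
  have [sA <-] := csum_prod (herz_kernel_absum x hf hg sw)
    (herz_kernel_absum x hf' hg' sw').
  (* The second convolution variable is written y t. Then f'(x^-1 y t) is the right translate of f'
     by [t] taken at x^-1 y, the point where f is taken. *)
  pose e (k : nat * nat * G * G) :=
    ((k.1.1.1, k.2), (k.1.1.2, (k.2 * k.1.2)%g)).
  have be : bijective e.
    exists (fun k : nat * G * (nat * G) =>
      (k.1.1, k.2.1, (k.1.2^-1 * k.2.2)%g, k.1.2)).
      by move=> [[[i j] t] y]; rewrite /e /= mulgA mulVg mul1g.
    by move=> [[i y] [j z]]; rewrite /e /= mulgA mulgV mul1g.
  have [_ ->] := csum_bij be sA.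
  congr csum; apply/funext => -[[[i j] t] y] /=.
  by rewrite /F /K /= mulgA mulrACA.
- rewrite eW (le_lt_trans hO)// eP ltr_pM//.
  + by apply: rsum_ge0 => i; exact: weight_ge0.
  + by apply: rsum_ge0 => i; exact: weight_ge0.
Qed.

Lemma Apn_conv (f g : G -> C) r : in_lp p f -> in_lp q g ->
  nrm p f * nrm q g < r -> Apn (Defs.conv g (check f)) r.
Proof.
move=> hf hg h.
pose F (_ : unit) := f; pose K (_ : unit) := g.
have us : uniq [:: tt] by [].
have ns b : b \notin [:: tt] -> False by case: b.
have [|b /ns//|sW eW] := summ_finite us (f := weight F K).
  by move=> b; exact: weight_ge0.
apply: (@Apn_rep _ _ F K).
- by apply: finite_set_countable; exact: finite_finset.
- split; [by []|by []|exact: sW|move=> x].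
  have [_ _ ->] := csum_pair (@herz_kernel_absum _ F K x (fun=> hf) (fun=> hg) sW).
  have [b /ns//|_ ->] := csum_finite us
    (F := fun b : unit => csum (fun y => K b y * F b (x^-1 * y)%g)).
  by rewrite big_seq1 convE.
- by rewrite eW big_seq1.
Qed.

Lemma conv_addl (f g g' : G -> C) : in_lp p f -> in_lp q g -> in_lp q g' ->
  Defs.conv (fun y => g y + g' y) (check f) =
  fun x => Defs.conv g (check f) x + Defs.conv g' (check f) x.
Proof.
move=> hf hg hg'; apply/funext => x; rewrite !convE.
have [s1 _] := kernel_summ p0 q0 pq x hf hg.
have [s2 _] := kernel_summ p0 q0 pq x hf hg'.
rewrite -(proj2 (csumD s1 s2)); congr csum; apply/funext => y.
by rewrite mulrDl.
Qed.

Lemma conv_addr (f f' g : G -> C) : in_lp p f -> in_lp p f' -> in_lp q g ->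
  Defs.conv g (check (fun y => f y + f' y)) =
  fun x => Defs.conv g (check f) x + Defs.conv g (check f') x.
Proof.
move=> hf hf' hg; apply/funext => x; rewrite !convE.
have [s1 _] := kernel_summ p0 q0 pq x hf hg.
have [s2 _] := kernel_summ p0 q0 pq x hf' hg.
rewrite -(proj2 (csumD s1 s2)); congr csum; apply/funext => y.
by rewrite mulrDr.
Qed.

Lemma conv0r (g : G -> C) x : Defs.conv g (check (fun=> 0)) x = 0.
Proof. by rewrite convE; under eq_fun do rewrite mulr0; rewrite csum0. Qed.

Lemma Apn0 e : 0 < e -> Apn (fun=> 0) e.
Proof.
move=> e0; have [h1 h2] := @lp_zero R G p p0; have [h3 _] := @lp_zero R G q q0.
have := @Apn_conv _ _ e h1 h3; rewrite h2 mul0r => /(_ e0).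
by rewrite (_ : Defs.conv _ _ = fun=> 0)//; apply/funext => x; rewrite conv0r.
Qed.

Definition fsupp (h : G -> C) : Prop :=
  exists s : seq G, forall x, x \notin s -> h x = 0.

Lemma fsupp_add h h' : fsupp h -> fsupp h' -> fsupp (fun x => h x + h' x).
Proof.
move=> [s hs] [s' hs']; exists (s ++ s') => x; rewrite mem_cat negb_or.
by move=> /andP[/hs -> /hs' ->]; rewrite addr0.
Qed.

Lemma finite_mem_seq (A : set G) : finite_set A ->
  exists s : seq G, forall x, (x \in A) = (x \in s).
Proof.
by move=> /finite_seqP[s ->]; exists s => x; rewrite mem_setE.
Qed.

Lemma conv_fsupp (f g : G -> C) : fsupp f -> fsupp g -> fsupp (Defs.conv g (check f)).
Proof.
move=> [sB hB] [sA hA]; exists [seq (y * z^-1)%g | y <- sA, z <- sB] => x hx.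
rewrite convE (_ : (fun y => _) = fun=> 0) ?csum0//; apply/funext => y.
have [yA|/hA ->] := boolP (y \in sA); last by rewrite mul0r.
have [zB|/hB ->] := boolP ((x^-1 * y)%g \in sB); last by rewrite mulr0.
case/negP: hx; apply/allpairsP; exists (y, (x^-1 * y)%g); split=> //=.
by rewrite invgM invgK mulgA mulgV mul1g.
Qed.

Lemma conv_approx (f g : G -> C) e : in_lp p f -> in_lp q g -> 0 < e ->
  exists2 h, fsupp h & Apn (fun x => Defs.conv g (check f) x - h x) e.
Proof.
move=> hf hg e0.
have nf := nrm_ge0 p f; have ng := nrm_ge0 q g.
have [A fA hA] := lp_tail q0 hg (e := e / 2 / (nrm p f + 1))
  (ltac:(by rewrite !divr_gt0// ltr_wpDl)).
have [B fB hB] := lp_tail p0 hf (e := e / 2 / (nrm q g + 1))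
  (ltac:(by rewrite !divr_gt0// ltr_wpDl)).
pose gA y := if y \in A then g y else 0.
pose gA' y := if y \in A then 0 else g y.
pose fB_ y := if y \in B then f y else 0.
pose fB' y := if y \in B then 0 else f y.
have [igA ngA] : in_lp q gA /\ nrm q gA <= nrm q g.
  by apply: lp_le => // x; rewrite /gA; case: ifP => // _; rewrite cabs0 cabs_ge0.
have [igA' _] : in_lp q gA' /\ nrm q gA' <= nrm q g.
  by apply: lp_le => // x; rewrite /gA'; case: ifP => // _; rewrite cabs0 cabs_ge0.
have [ifB _] : in_lp p fB_ /\ nrm p fB_ <= nrm p f.
  by apply: lp_le => // x; rewrite /fB_; case: ifP => // _; rewrite cabs0 cabs_ge0.
have [ifB' _] : in_lp p fB' /\ nrm p fB' <= nrm p f.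
  by apply: lp_le => // x; rewrite /fB'; case: ifP => // _; rewrite cabs0 cabs_ge0.
exists (Defs.conv gA (check fB_)).
  have [sA hsA] := finite_mem_seq fA; have [sB hsB] := finite_mem_seq fB.
  apply: conv_fsupp; [exists sB|exists sA] => x /negbTE hx.
  - by rewrite /fB_ hsB hx.
  - by rewrite /gA hsA hx.
(* Truncating one factor at a time leaves two error terms, each containing one tail. The [+ 1] in
   the choice of [A] and [B] avoids division by zero and keeps each term below e/2. *)
have -> : (fun x => Defs.conv g (check f) x - Defs.conv gA (check fB_) x) =
    (fun x => Defs.conv gA' (check f) x + Defs.conv gA (check fB') x).
  have Eg : g = fun y => gA y + gA' y.
    by apply/funext => y; rewrite /gA /gA'; case: ifP; rewrite ?addr0 ?add0r.
  have Ef : f = fun y => fB_ y + fB' y.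
    by apply/funext => y; rewrite /fB_ /fB'; case: ifP; rewrite ?addr0 ?add0r.
  have E1 := conv_addl hf igA igA'; rewrite -Eg in E1.
  have E2 := conv_addr ifB ifB' igA; rewrite -Ef in E2.
  apply/funext => x; rewrite E1 E2; ring.
rewrite [e]splitr; apply: Apn_add; apply: Apn_conv => //.
- rewrite (@le_lt_trans _ _ (nrm p f * (e / 2 / (nrm p f + 1))))//.
    by rewrite ler_wpM2l// ltW.
  rewrite mulrA ltr_pdivrMr ?ltr_wpDl//; nra.
- rewrite (@le_lt_trans _ _ (e / 2 / (nrm q g + 1) * nrm q g))//.
    by rewrite ler_pM ?nrm_ge0// ltW.
  rewrite mulrAC ltr_pdivrMr ?ltr_wpDl//; nra.
Qed.

Lemma conv_sum_approx (f g : nat -> G -> C) (s : seq nat) (e : R) :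
  (forall i, in_lp p (f i)) -> (forall i, in_lp q (g i)) -> 0 < e ->
  exists2 h, fsupp h &
    Apn (fun x => \sum_(i <- s) Defs.conv (g i) (check (f i)) x - h x) e.
Proof.
move=> hf hg; elim: s e => [|i s IH] e e0.
  exists (fun=> 0); first by exists [::].
  by under eq_fun do rewrite big_nil subr0; exact: Apn0.
have e2 : 0 < e / 2 by rewrite divr_gt0.
have [h1 s1 a1] := conv_approx (hf i) (hg i) e2.
have [h2 s2 a2] := IH _ e2.
exists (fun x => h1 x + h2 x); first exact: fsupp_add.
rewrite [e]splitr; have := Apn_add a1 a2.
congr Apn; apply/funext => x; rewrite big_cons; ring.
Qed.

Lemma Apn_tail u (f g : nat -> G -> C) (e : R) : herz_rep u f g -> 0 < e ->
  exists s : seq nat,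
    Apn (fun x => u x - \sum_(i <- s) Defs.conv (g i) (check (f i)) x) e.
Proof.
move=> H e0; have [hf hg sw hu] := H.
have [A /finite_seqP[s0 As] hA] := rsum_tail sw e0.
pose s := undup s0; have us : uniq s by exact: undup_uniq.
have As' i : (i \in A) = (i \in s) by rewrite As mem_setE mem_undup.
(* Setting only [f] to zero on [s] already kills these terms and their weights, so the remainder is
   represented over the same index set. *)
pose f' i := if i \in s then fun=> 0 else f i.
have hf' i : in_lp p (f' i).
  by rewrite /f'; case: ifP => // _; exact: (proj1 (lp_zero _ p0)).
have W : weight f' g = fun i => if i \in A then 0 else weight f g i.
  apply/funext => i; rewrite /weight /f' As'; case: ifP => // _.
  by rewrite (proj2 (lp_zero _ p0)) mul0r.
have sW : summ (weight f' g) by rewrite W; exact: (proj2 (summ_cut A sw)).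
pose u' x := csum (fun k : nat * G => g k.1 k.2 * f' k.1 (x^-1 * k.2)%g).
have H' : herz_rep u' f' g by split.
exists s, f', g; rewrite W; split=> //.
suff -> : (fun x => u x - \sum_(i <- s) Defs.conv (g i) (check (f i)) x) = u' by [].
apply/funext => x; have [s1 E1] := herz_rep_conv H x.
have [s2 E2] := herz_rep_conv H' x.
pose c i := if i \in s then Defs.conv (g i) (check (f i)) x else 0.
have [|s3 E3] := @csum_finite R _ s c us.
  by move=> i /negbTE hi; rewrite /c hi.
have := proj2 (csumD s2 s3); rewrite -E2 E3.
rewrite (_ : \sum_(i <- s) c i = \sum_(i <- s) Defs.conv (g i) (check (f i)) x).
  move=> E; apply/eqP; rewrite subr_eq -E E1; apply/eqP; congr csum; apply/funext => i.
  by rewrite /c /f'; case: ifP => _; rewrite ?conv0r ?add0r ?addr0.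
by apply: eq_big_seq => i; rewrite /c => ->.
Qed.

Lemma Apn_dense u (r e : R) : Apn u r -> 0 < e ->
  exists2 h, fsupp h & Apn (fun x => u x - h x) e.
Proof.
move=> [f [g [H _]]] e0; have [hf hg _ _] := H.
have e2 : 0 < e / 2 by rewrite divr_gt0.
have [s a1] := Apn_tail H e2.
have [h sh a2] := conv_sum_approx s hf hg e2.
exists h => //; rewrite [e]splitr; have := Apn_add a1 a2.
by under eq_fun do rewrite addrA subrK.
Qed.

Definition dlt (x : G) : G -> C := fun y => if y == x then 1 else 0.

Lemma nrm_dlt (r : R) x : 0 < r -> in_lp r (dlt x) /\ nrm r (dlt x) = 1.
Proof.
move=> r0.
have [y|y|s e] := @summ_finite R _ [:: x] (fun y => cabs (dlt x y) `^ r) isT.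
- exact: powR_ge0.
- by rewrite inE /dlt => /negbTE ->; rewrite cabs0 powR0// gt_eqF.
split; first exact/in_lpP.
by rewrite nrm_rsum e big_seq1 /dlt eqxx cabs1 !powR1.
Qed.

(** The point mass at [x] is the convolution of [dlt x] with the reflection of the point mass at 1,
    two functions of norm 1. *)
Lemma Apn_dlt x r : 1 < r -> Apn (dlt x) r.
Proof.
move=> r1; have [i1 n1] := nrm_dlt 1%g p0; have [i2 n2] := nrm_dlt x q0.
have := @Apn_conv _ _ r i1 i2; rewrite n1 n2 mulr1 => /(_ r1).
rewrite (_ : Defs.conv _ _ = dlt x)//; apply/funext => z; rewrite convE.
have [|_ ->] := @csum_finite R _ [:: x] (fun y => dlt x y * dlt 1 (z^-1 * y)%g) isT.
  by move=> y; rewrite inE /dlt => /negbTE ->; rewrite mul0r.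
rewrite big_seq1 /dlt eqxx mul1r; congr (if _ then _ else _).
apply/eqP/eqP => [h|->]; last by rewrite mulVg.
by have := congr1 (fun w => (z * w)%g) h; rewrite mulgA mulgV mul1g mulg1.
Qed.

End HerzAlgebra.

(** * The norm of Ap(G), recovered from strict bounds *)

Section HerzNorm.
Variables (R : realType) (G : groupType) (p : R).
Hypotheses (cG : countable [set: G]) (p1 : 1 < p).
Local Notation C := (Cx R).
Local Notation q := (conj_exp p).
Local Notation Apn := (Apn p q).
Implicit Types (u v : G -> C).

Let p0 : 0 < p. Proof. by rewrite (lt_trans ltr01). Qed.
Let q0 : 0 < q. Proof. by rewrite (lt_trans ltr01)// conj_exp_gt1. Qed.
Let pq := conj_expV p1.

Lemma in_ApP u : in_Ap p u <-> exists r, Apn u r.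
Proof.
split=> [[f [g /(Ap_repE p0 q0 pq _ _ _ erefl) h]]|[r [f [g [h _]]]]].
  by exists (rsum (weight p q f g) + 1), f, g; rewrite ltrDl.
by exists f, g; apply/(Ap_repE p0 q0 pq _ _ _ erefl).
Qed.

Lemma Ap_norm_set u : [set r : R | exists f g, Ap_rep p u f g /\
    r = fine (\esum_(i in [set: nat]) (lp_norm p (f i) * lp_norm q (g i))%:E)] =
  [set r : R | exists f g : nat -> G -> C, herz_rep p q u f g /\
    r = rsum (weight p q f g)].
Proof.
apply/seteqP; split=> r [f [g [h ->]]]; exists f, g;
  move: h => /(Ap_repE p0 q0 pq _ _ _ erefl) h; split=> //.
- by rewrite rsum_def esumT_weight.
- by rewrite rsum_def esumT_weight.
Qed.

Lemma Ap_norm_lb u :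
  lbound [set r : R | exists f g : nat -> G -> C, herz_rep p q u f g /\
    r = rsum (weight p q f g)] 0.
Proof.
by move=> r [f [g [_ ->]]]; apply: rsum_ge0 => i; exact: weight_ge0.
Qed.

Lemma Ap_norm_ge0 u : 0 <= Ap_norm p u.
Proof.
rewrite /Ap_norm Ap_norm_set; set S := [set r | _].
have [->|/set0P hS] := eqVneq S set0; first by rewrite inf0.
by apply: lb_le_inf => //; exact: Ap_norm_lb.
Qed.

Lemma Apn_norm u r : Apn u r -> in_Ap p u /\ Ap_norm p u < r.
Proof.
move=> h; split; first by apply/in_ApP; exists r.
have [f [g [hr wr]]] := h; apply: le_lt_trans wr.
rewrite /Ap_norm Ap_norm_set; apply: ge_inf; last by exists f, g.
by exists 0; exact: Ap_norm_lb.
Qed.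

(** Membership is a separate assumption because the infimum of the empty set is 0: a small value of
    [Ap_norm] alone yields no representation. *)
Lemma norm_Apn u r : in_Ap p u -> Ap_norm p u < r -> Apn u r.
Proof.
move=> /in_ApP[s [f [g [hr _]]]]; rewrite /Ap_norm Ap_norm_set => /inf_lt.
move=> [|_ [f' [g' [h' ->]]] lt].
  by exists (rsum (weight p q f g)), f, g.
by exists f', g'.
Qed.

Lemma Ap_norm_eps u e : in_Ap p u -> 0 < e -> Apn u (Ap_norm p u + e).
Proof. by move=> h e0; apply: norm_Apn => //; rewrite ltrDl. Qed.

Lemma Ap_add u v : in_Ap p u -> in_Ap p v ->
  in_Ap p (fun x => u x + v x) /\
  Ap_norm p (fun x => u x + v x) <= Ap_norm p u + Ap_norm p v.
Proof.
move=> hu hv.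
have key (e : R) : 0 < e -> Apn (fun x => u x + v x) (Ap_norm p u + Ap_norm p v + e).
  move=> e0; have e2 : 0 < e / 2 by rewrite divr_gt0.
  have := Apn_add p0 q0 pq (Ap_norm_eps hu e2) (Ap_norm_eps hv e2).
  by rewrite addrACA -splitr.
split; first by have [] := Apn_norm (key 1 ltr01).
by apply/ler_addgt0Pr => e /key /Apn_norm[_ /ltW].
Qed.

Lemma Ap_scale a u : in_Ap p u ->
  in_Ap p (fun x => a * u x) /\ Ap_norm p (fun x => a * u x) <= cabs a * Ap_norm p u.
Proof.
move=> hu.
have key (e : R) : 0 < e -> Apn (fun x => a * u x) (cabs a * Ap_norm p u + e).
  move=> e0; have a0 := cabs_ge0 a.
  have d0 : 0 < e / (cabs a + 1) by rewrite divr_gt0// ltr_wpDl.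
  apply: (Apn_scale p0 q0 pq (Ap_norm_eps hu d0)).
  rewrite mulrDr ltrD2l mulrA ltr_pdivrMr ?ltr_wpDl//; nra.
split; first by have [] := Apn_norm (key 1 ltr01).
by apply/ler_addgt0Pr => e /key /Apn_norm[_ /ltW].
Qed.

Lemma Ap_mul u v : in_Ap p u -> in_Ap p v ->
  in_Ap p (pmul u v) /\ Ap_norm p (pmul u v) <= Ap_norm p u * Ap_norm p v.
Proof.
move=> hu hv; have nu := Ap_norm_ge0 u; have nv := Ap_norm_ge0 v.
have key (d : R) : 0 < d -> Apn (pmul u v) ((Ap_norm p u + d) * (Ap_norm p v + d)).
  by move=> d0; apply: (Apn_mul p0 q0 pq cG); exact: Ap_norm_eps.
split; first by have [] := Apn_norm (key 1 ltr01).
suff arith (U V r : R) : 0 <= U -> 0 <= V ->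
    (forall d, 0 < d -> r <= (U + d) * (V + d)) -> r <= U * V.
  by apply: arith => // d /key /Apn_norm[_ /ltW].
move=> {u v hu hv nu nv key} U0 V0 key; apply/ler_addgt0Pr => e e0.
have K0 : 0 < U + V + 1 by lra.
(* (U + d)(V + d) exceeds U V by d (U + V + d), which is at most [e] for this [d]. *)
pose d := Num.min 1 (e / (U + V + 1)).
have d0 : 0 < d by rewrite lt_min ltr01 divr_gt0.
have d1 : d <= 1 by rewrite ge_min lexx.
have dK : d * (U + V + 1) <= e by rewrite -ler_pdivlMr// ge_min lexx orbT.
rewrite (le_trans (key _ d0))//; nra.
Qed.

Lemma Ap_dlt (x : G) : in_Ap p (dlt R x) /\ Ap_norm p (dlt R x) <= 1.
Proof.
have key (e : R) : 0 < e -> Apn (dlt R x) (1 + e).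
  by move=> e0; apply: (Apn_dlt p0 q0 pq); rewrite ltrDl.
split; first by have [] := Apn_norm (key 1 ltr01).
by apply/ler_addgt0Pr => e /key /Apn_norm[_ /ltW].
Qed.

Lemma Ap_dense u e : in_Ap p u -> 0 < e ->
  exists2 h, fsupp h & in_Ap p (fun x => u x - h x) /\
    Ap_norm p (fun x => u x - h x) < e.
Proof.
move=> /in_ApP[r hr] e0; have [h sh a] := Apn_dense p0 q0 pq hr e0.
by exists h => //; exact: Apn_norm.
Qed.

Lemma Ap_conv (f g : G -> C) : in_lp p f -> in_lp q g ->
  in_Ap p (Defs.conv g (check f)) /\
  Ap_norm p (Defs.conv g (check f)) <= nrm p f * nrm q g.
Proof.
move=> hf hg.
have key (e : R) : 0 < e -> Apn (Defs.conv g (check f)) (nrm p f * nrm q g + e).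
  by move=> e0; apply: (Apn_conv p0 q0 pq) => //; rewrite ltrDl.
split; first by have [] := Apn_norm (key 1 ltr01).
by apply/ler_addgt0Pr => e /key /Apn_norm[_ /ltW].
Qed.

End HerzNorm.

(** * Duals of Ap(G) *)

HB.lock Definition An (R : realType) (G : groupType) (p : R) (u : G -> Cx R) : R :=
  Ap_norm p u.
HB.lock Definition Dn (R : realType) (G : groupType) (p : R)
  (T : (G -> Cx R) -> Cx R) : R := Ap_dual_norm p T.

Section Duals.
Variables (R : realType) (G : groupType) (p : R).
Hypotheses (cG : countable [set: G]) (p1 : 1 < p).
Local Notation C := (Cx R).
Implicit Types (u v a b : G -> C) (T S : (G -> C) -> C).

Lemma AnE u : An p u = Ap_norm p u. Proof. by rewrite An.unlock. Qed.
Lemma DnE T : Dn p T = Ap_dual_norm p T. Proof. by rewrite Dn.unlock. Qed.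

Lemma An_ge0 u : 0 <= An p u. Proof. by rewrite AnE; exact: Ap_norm_ge0. Qed.

Lemma An_add u v : in_Ap p u -> in_Ap p v ->
  in_Ap p (fun x => u x + v x) /\ An p (fun x => u x + v x) <= An p u + An p v.
Proof. by rewrite !AnE; exact: Ap_add. Qed.

Lemma An_scale (c : C) u : in_Ap p u ->
  in_Ap p (fun x => c * u x) /\ An p (fun x => c * u x) <= cabs c * An p u.
Proof. by rewrite !AnE; exact: Ap_scale. Qed.

Lemma An_mul u v : in_Ap p u -> in_Ap p v ->
  in_Ap p (pmul u v) /\ An p (pmul u v) <= An p u * An p v.
Proof. by rewrite !AnE; exact: Ap_mul. Qed.

Lemma ballP u : Ap_ball p u <-> in_Ap p u /\ An p u <= 1.
Proof. by rewrite AnE. Qed.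

Lemma Ap0 : in_Ap p (fun _ : G => 0 : C) /\ An p (fun _ : G => 0 : C) = 0.
Proof.
have [h1 h2] := An_scale 0 (proj1 (Ap_dlt p1 1%g)).
have E : (fun x : G => 0 * dlt R 1%g x) = fun=> 0 :> C.
  by apply/funext => x; rewrite mul0r.
rewrite E cabs0 mul0r in h1 h2; split=> //.
by apply/eqP; rewrite eq_le h2 An_ge0.
Qed.

Lemma ball0 : Ap_ball p (fun _ : G => 0 : C).
Proof. by have [h e] := Ap0; apply/ballP; rewrite e ler01. Qed.

Lemma in_Ap_lin (c : C) u v : in_Ap p u -> in_Ap p v -> in_Ap p (fun x => c * u x + v x).
Proof. by move=> hu hv; have [h _] := An_add (proj1 (An_scale c hu)) hv. Qed.

Lemma dual0 T : Ap_linear p T -> T (fun=> 0) = 0.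
Proof.
move=> lT; have [h _] := Ap0; have := lT 1 _ _ h h.
under [X in T X]eq_fun do rewrite mulr0 addr0.
by rewrite mul1r => /eqP; rewrite -subr_eq0 opprD addrA subrr sub0r oppr_eq0 => /eqP.
Qed.

Lemma dualZ T (c : C) u : Ap_linear p T -> in_Ap p u -> T (fun x => c * u x) = c * T u.
Proof.
move=> lT hu; have [h _] := Ap0; have := lT c _ _ hu h.
by rewrite dual0// addr0; under [X in T X]eq_fun do rewrite addr0.
Qed.

Lemma dualD T u v : Ap_linear p T -> in_Ap p u -> in_Ap p v ->
  T (fun x => u x + v x) = T u + T v.
Proof.
move=> lT hu hv; have := lT 1 _ _ hu hv.
by rewrite mul1r; under [X in T X]eq_fun do rewrite mul1r.
Qed.

Lemma dualB T u v : Ap_linear p T -> in_Ap p u -> in_Ap p v ->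
  T (fun x => u x - v x) = T u - T v.
Proof.
move=> lT hu hv; have := lT (-1) _ _ hv hu; rewrite mulN1r addrC => <-.
by congr T; apply/funext => x; rewrite mulN1r addrC.
Qed.

Lemma dualP T : in_Ap_dual p T <-> Ap_linear p T /\
  exists2 M : R, 0 <= M & forall u, in_Ap p u -> cabs (T u) <= M * An p u.
Proof.
split=> [[lT [M hM]]|[lT [M M0 hM]]]; split=> //; last first.
  by exists M => u /hM; rewrite AnE.
exists (Num.max M 0) => [|u /hM h]; first by rewrite le_max lexx orbT.
by rewrite (le_trans h)// -AnE ler_wpM2r ?An_ge0// le_max lexx.
Qed.

Lemma Dn_ub T : in_Ap_dual p T -> has_ubound ((fun u => cabs (T u)) @` Ap_ball p).
Proof.
move=> /dualP[_ [M M0 hM]]; exists M => _ [u /ballP[hu nu] <-].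
by rewrite (le_trans (hM _ hu))// ler_piMr.
Qed.

Lemma Dn_ball T u : in_Ap_dual p T -> Ap_ball p u -> cabs (T u) <= Dn p T.
Proof.
move=> hT hu; rewrite DnE; apply: ub_le_sup; first exact: Dn_ub.
by exists u.
Qed.

Lemma Dn_ge0 T : in_Ap_dual p T -> 0 <= Dn p T.
Proof. by move=> hT; exact: le_trans (cabs_ge0 _) (Dn_ball hT ball0). Qed.

Lemma Dn_le T (M : R) : (forall u, Ap_ball p u -> cabs (T u) <= M) -> Dn p T <= M.
Proof.
move=> h; rewrite DnE; apply: ge_sup; last by move=> _ [u hu <-]; exact: h.
by exists (cabs (T (fun=> 0))), (fun=> 0) => //; exact: ball0.
Qed.

Lemma Dn_bound T u : in_Ap_dual p T -> in_Ap p u -> cabs (T u) <= Dn p T * An p u.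
Proof.
move=> hT hu; have [lT [M M0 hM]] := (dualP T).1 hT.
(* An element of norm 0 cannot be normalized; for it the bound [M] from the definition of the dual
   gives [T u = 0]. *)
have [E|n0] := eqVneq (An p u) 0.
  by rewrite E mulr0; have := hM _ hu; rewrite E mulr0.
have pos : 0 < An p u by rewrite lt_def n0 An_ge0.
pose c : C := ofR (An p u)^-1.
have cE : cabs c = (An p u)^-1 by rewrite cabs_ofR ger0_norm// invr_ge0 An_ge0.
have [h1 h2] := An_scale c hu.
have hb : Ap_ball p (fun x => c * u x).
  by apply/ballP; split=> //; rewrite (le_trans h2)// cE mulVf.
have := Dn_ball hT hb; rewrite dualZ// cabsM cE.
by rewrite ler_pdivrMl// mulrC.
Qed.

Lemma in_Ap_dual_lin (c : C) T S : in_Ap_dual p T -> in_Ap_dual p S ->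
  in_Ap_dual p (fun u => c * T u + S u).
Proof.
move=> /dualP[lT [M M0 hM]] /dualP[lS [N N0 hN]]; apply/dualP; split.
  by move=> d u v hu hv; rewrite lT// lS//; ring.
exists (cabs c * M + N); first by rewrite addr_ge0// mulr_ge0// cabs_ge0.
move=> u hu; rewrite mulrDl (le_trans (cabsD _ _))// lerD ?hN// cabsM -mulrA.
by rewrite ler_wpM2l ?cabs_ge0 ?hM.
Qed.

Lemma in_Ap_dual0 : in_Ap_dual p (fun _ : G -> C => 0 : C).
Proof.
apply/dualP; split; first by move=> d u v _ _; rewrite mulr0 addr0.
by exists 0 => // u _; rewrite cabs0 mul0r.
Qed.

Lemma in_Ap_dual_sum (ss : seq (C * ((G -> C) -> C))) :
  (forall cS, List.In cS ss -> in_Ap_dual p cS.2) ->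
  in_Ap_dual p (fun u => \sum_(cS <- ss) cS.1 * cS.2 u).
Proof.
elim: ss => [_|cS ss IH h].
  by under eq_fun do rewrite big_nil; exact: in_Ap_dual0.
under eq_fun do rewrite big_cons.
apply: in_Ap_dual_lin; first by apply: h; left.
by apply: IH => cS' h'; apply: h; right.
Qed.

Lemma bidual0 F : in_Ap_bidual p F -> F (fun _ : G -> C => 0 : C) = 0.
Proof.
move=> [lF _ _]; have := lF 1 _ _ in_Ap_dual0 in_Ap_dual0.
rewrite (_ : (fun u : G -> C => _) = fun=> 0).
  by rewrite mul1r => /eqP; rewrite -subr_eq0 opprD addrA subrr sub0r oppr_eq0 => /eqP.
by apply/funext => u; rewrite mulr0 addr0.
Qed.

Lemma bidual_sum F (ss : seq (C * ((G -> C) -> C))) : in_Ap_bidual p F ->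
  (forall cS, List.In cS ss -> in_Ap_dual p cS.2) ->
  F (fun u => \sum_(cS <- ss) cS.1 * cS.2 u) = \sum_(cS <- ss) cS.1 * F cS.2.
Proof.
move=> hF; have [lF _ _] := hF; elim: ss => [_|cS ss IH h].
  by under eq_fun do rewrite big_nil; rewrite big_nil bidual0.
have h' cS' : List.In cS' ss -> in_Ap_dual p cS'.2 by move=> ?; apply: h; right.
under eq_fun do rewrite big_cons.
rewrite lF ?big_cons ?IH//; first by apply: h; left.
exact: in_Ap_dual_sum.
Qed.

Lemma bidual_bound F : in_Ap_bidual p F ->
  exists2 M : R, 0 < M & forall T, in_Ap_dual p T -> cabs (F T) <= M * Dn p T.
Proof.
move=> [_ _ [M hM]]; exists (`|M| + 1); first by rewrite ltr_wpDl.
move=> T hT; rewrite (le_trans (hM _ hT))// -DnE ler_wpM2r ?Dn_ge0//.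
by rewrite (le_trans (ler_norm _))// lerDl.
Qed.

Lemma pmul_linr (c : C) a u v :
  pmul a (fun x => c * u x + v x) = fun x => c * pmul a u x + pmul a v x.
Proof. by apply/funext => x; rewrite /pmul; ring. Qed.

Lemma pmul_linl (c : C) a u v :
  pmul (fun x => c * u x + v x) a = fun x => c * pmul u a x + pmul v a x.
Proof. by apply/funext => x; rewrite /pmul; ring. Qed.

Lemma pmulC a b : pmul a b = pmul b a.
Proof. by apply/funext => x; rewrite /pmul mulrC. Qed.

Lemma dual_lmulE a T : dual_lmul a T = dual_rmul T a.
Proof. by apply/funext => b; rewrite /dual_lmul /dual_rmul pmulC. Qed.

Lemma in_dual_rmul T a : in_Ap_dual p T -> in_Ap p a ->
  in_Ap_dual p (dual_rmul T a) /\ Dn p (dual_rmul T a) <= Dn p T * An p a.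
Proof.
move=> hT ha; have [lT _] := hT.
have hM u : in_Ap p u -> cabs (dual_rmul T a u) <= Dn p T * An p a * An p u.
  move=> hu; have [h1 h2] := An_mul ha hu.
  rewrite (le_trans (Dn_bound hT h1))// -mulrA ler_wpM2l// Dn_ge0//.
split.
  apply/dualP; split.
    move=> c u v hu hv; rewrite /dual_rmul pmul_linr.
    by apply: lT; [exact: (proj1 (An_mul ha hu))|exact: (proj1 (An_mul ha hv))].
  by exists (Dn p T * An p a) => //; rewrite mulr_ge0 ?An_ge0 ?Dn_ge0.
apply: Dn_le => u /ballP[hu nu]; rewrite (le_trans (hM _ hu))//.
by rewrite ler_piMr// mulr_ge0 ?An_ge0 ?Dn_ge0.
Qed.

Lemma in_bidual_dual F T : in_Ap_bidual p F -> in_Ap_dual p T ->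
  in_Ap_dual p (bidual_dual F T).
Proof.
move=> hF hT; have [lF eF _] := hF; have [M M0 hM] := bidual_bound hF.
have [lT _] := hT; apply/dualP; split.
  move=> c u v hu hv; rewrite /bidual_dual -lF.
  (* [T] is linear on Ap(G) only, so the two functionals agree there but perhaps not as functions;
     [F] has to respect such classes. *)
  - apply: eF => b hb; rewrite /dual_rmul pmul_linl.
    by apply: lT; [exact: (proj1 (An_mul hu hb))|exact: (proj1 (An_mul hv hb))].
  - exact: (proj1 (in_dual_rmul hT hu)).
  - exact: (proj1 (in_dual_rmul hT hv)).
exists (M * Dn p T); first by rewrite mulr_ge0 ?Dn_ge0// ltW.
move=> u hu; have [h1 h2] := in_dual_rmul hT hu.
by rewrite (le_trans (hM _ h1))// -mulrA ler_pM2l.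
Qed.

(** By commutativity of the pointwise product; hence [arens2 F H] is [arens1 H F]. *)
Lemma dual_bidualE F T : dual_bidual T F = bidual_dual F T.
Proof. by apply/funext => a; rewrite /dual_bidual /bidual_dual dual_lmulE. Qed.

Lemma ball_convex (t : R) u v : 0 <= t <= 1 -> Ap_ball p u -> Ap_ball p v ->
  Ap_ball p (fun x => ofR t * v x + ofR (1 - t) * u x).
Proof.
move=> /andP[t0 t1] /ballP[hu nu] /ballP[hv nv].
have [i1 n1] := An_scale (ofR t) hv; have [i2 n2] := An_scale (ofR (1 - t)) hu.
have [i3 n3] := An_add i1 i2; apply/ballP; split=> //.
have t1' : 0 <= 1 - t by rewrite subr_ge0.
rewrite cabs_ofR ger0_norm// in n1; rewrite cabs_ofR ger0_norm// in n2.
rewrite (le_trans n3)// (le_trans (lerD n1 n2))//.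
have h1 : t * An p v <= t by rewrite ler_piMr.
have h2 : (1 - t) * An p u <= 1 - t by rewrite ler_piMr.
by rewrite (le_trans (lerD h1 h2))// addrC subrK.
Qed.

Lemma ball_scale (c : C) u : cabs c <= 1 -> Ap_ball p u -> Ap_ball p (fun x => c * u x).
Proof.
move=> hc /ballP[hu nu]; have [i n] := An_scale c hu; apply/ballP; split=> //.
by rewrite (le_trans n)// mulr_ile1 ?cabs_ge0 ?An_ge0.
Qed.

(** The inner product of [C] seen as the real plane. Summed over finitely many functionals it is the
    Hilbert space structure used in [helly]. *)
Definition rip (z w : C) : R :=
  complex.Re z * complex.Re w + complex.Im z * complex.Im w.
Definition cj (z : C) : C := (complex.Re z -i* complex.Im z)%C.

Lemma cabs_sqr (z : C) : cabs z ^+ 2 = rip z z.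
Proof. by case: z => a b; rewrite /cabs /rip /= sqr_sqrtr ?addr_ge0 ?sqr_ge0// -!expr2. Qed.

Lemma rip_cj (z w : C) : rip z w = complex.Re (cj z * w).
Proof. by case: z w => a b [c d]; rewrite /rip /cj /=; ring. Qed.

Lemma ReD (z w : C) : complex.Re (z + w) = complex.Re z + complex.Re w.
Proof. by case: z w => a b [c d]. Qed.

Lemma ReB (z w : C) : complex.Re (z - w) = complex.Re z - complex.Re w.
Proof. by case: z w => a b [c d]. Qed.

Lemma Re_ofR (r : R) : complex.Re (ofR r) = r. Proof. by []. Qed.

Lemma Re_sum (I : Type) (s : seq I) (F : I -> C) :
  complex.Re (\sum_(i <- s) F i) = \sum_(i <- s) complex.Re (F i).
Proof.
elim: s => [|i s IH]; first by rewrite !big_nil.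
by rewrite !big_cons ReD IH.
Qed.

(** Expansion of |z + t (w - z)|^2 in powers of [t]. Near a minimum at t = 0 the linear coefficient
    cannot be very negative, which is how [helly] obtains a separating functional. *)
Lemma cabs_segment (t : R) (z w : C) :
  cabs (ofR t * w + ofR (1 - t) * z) ^+ 2 =
  cabs z ^+ 2 + 2 * t * (rip z w - cabs z ^+ 2) + t ^+ 2 * cabs (w - z) ^+ 2.
Proof.
rewrite !cabs_sqr; case: z w => a b [c d]; rewrite /rip /=; ring.
Qed.

Lemma unimodular_neg (z : C) : exists2 c : C, cabs c <= 1 & c * z = - ofR (cabs z).
Proof.
have [->|z0] := eqVneq z 0.
  by exists 0; rewrite ?cabs0 ?ler01// mul0r ofR0 oppr0.
have cz : cabs z != 0 by apply: contraNN z0 => /eqP/cabs_eq0 ->.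
exists (- ofR (cabs z) / z); last by rewrite divfK.
by rewrite cabsM cabsN cabs_ofR cabsV ger0_norm ?cabs_ge0// divff.
Qed.

(* An almost closest point of the convex image of the ball in
   the finite-dimensional Hilbert space indexed by [ss] separates as well as the
   closest one, so no compactness is needed. *)
Lemma helly F (M e : R) (ss : seq ((G -> C) -> C)) : in_Ap_bidual p F -> 0 < M ->
  (forall T, in_Ap_dual p T -> cabs (F T) <= M * Dn p T) -> 0 < e ->
  (forall S, List.In S ss -> in_Ap_dual p S) ->
  exists2 f, Ap_ball p f & forall S, List.In S ss -> cabs (ofR M * S f - F S) < e.
Proof.
move=> hF M0 hM e0 hss.
pose vv S f := ofR M * S f - F S.
pose Q f := \sum_(S <- ss) cabs (vv S f) ^+ 2.
have mem (P : ((G -> C) -> C) -> R) (c : R) : (forall S, 0 <= P S) ->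
    \sum_(S <- ss) P S < c -> forall S, List.In S ss -> P S < c.
  move=> P0; elim: (ss) c => [//|S' s IH] c; rewrite big_cons => h S.
  have s0 : 0 <= \sum_(S <- s) P S by apply: sumr_ge0.
  move=> [<-|]; first by rewrite (le_lt_trans _ h)// lerDl.
  by apply: IH; rewrite (le_lt_trans _ h)// lerDr.
have suml (P Q' : ((G -> C) -> C) -> R) : (forall S, List.In S ss -> P S <= Q' S) ->
    \sum_(S <- ss) P S <= \sum_(S <- ss) Q' S.
  elim: (ss) => [|S s IH] h; first by rewrite !big_nil.
  by rewrite !big_cons lerD ?IH// ?h//; [left|move=> S' hS'; apply: h; right].
have [[f hf Qf]|hno] := pselect (exists2 f, Ap_ball p f & Q f < e ^+ 2).
  exists f => // S hS; have := mem (fun S => cabs (vv S f) ^+ 2) _ _ Qf S hS.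
  rewrite ltr_pXn2r ?nnegrE ?cabs_ge0 ?(ltW e0)//; apply => S'.
  exact: sqr_ge0.
exfalso.
have Qge f : Ap_ball p f -> e ^+ 2 <= Q f.
  by move=> hf; rewrite leNgt; apply/negP => h; apply: hno; exists f.
pose D := [set r | exists2 f, Ap_ball p f & r = Q f].
have D0 : D !=set0 by exists (Q (fun=> 0)), (fun=> 0) => //; exact: ball0.
have Dlb : has_lbound D by exists (e ^+ 2) => _ [f hf ->]; exact: Qge.
pose d := inf D.
have de : e ^+ 2 <= d by apply: lb_le_inf => // _ [f hf ->]; exact: Qge.
have d0 : 0 < d by rewrite (lt_le_trans _ de)// exprn_gt0.
have dQ f : Ap_ball p f -> d <= Q f by move=> hf; apply: ge_inf => //; exists f.
have dE : inf D = d by [].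
clearbody d.
(* A bound for the squared diameter of the image of the ball; the [+ 1] keeps it positive even if
   [ss] is empty. *)
pose L := \sum_(S <- ss) (2 * M * Dn p S) ^+ 2 + 1.
have L0 : 0 < L by rewrite ltr_wpDl//; apply: sumr_ge0 => S _; exact: sqr_ge0.
have Lb f w : Ap_ball p f -> Ap_ball p w ->
    \sum_(S <- ss) cabs (vv S w - vv S f) ^+ 2 <= L.
  move=> hf hw; apply: (@le_trans _ _ (\sum_(S <- ss) (2 * M * Dn p S) ^+ 2)).
    apply: suml => S hS; have dS := hss S hS.
    rewrite lerXn2r ?nnegrE ?cabs_ge0 ?mulr_ge0 ?Dn_ge0 ?(ltW M0)//.
    rewrite /vv (_ : _ - _ - _ = ofR M * (S w - S f)); last by ring.
    rewrite cabsM cabs_ofR gtr0_norm// (mulrC 2) -mulrA ler_pM2l//.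
    rewrite (le_trans (cabsB _ _))// mulrDl mul1r.
    by rewrite lerD// Dn_ball.
  by rewrite /L lerDl.
(* The step towards a competitor [w]. The quadratic term then costs at most t d / 2, and [f] is
   chosen afterwards with Q f < d + t d / 2. Comparing Q at the new point with [d] leaves 2 t B w >=
   t d, which is [Bge]. *)
pose t := Num.min 1 (d / (2 * L)).
have t0 : 0 < t by rewrite lt_min ltr01/= divr_gt0// mulr_gt0.
have t1 : t <= 1 by rewrite ge_min lexx.
have tL : t * L <= d / 2.
  have : t <= d / (2 * L) by rewrite ge_min lexx orbT.
  by rewrite ler_pdivlMr ?mulr_gt0// ler_pdivlMr// -mulrA (mulrC L).
clearbody t L.
have [_ [f hf ->] Qf] : exists2 r, D r & r < inf D + t * d / 2.
  by apply: inf_adherent => //; rewrite divr_gt0// mulr_gt0.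
rewrite dE in Qf.
pose B w := \sum_(S <- ss) rip (vv S f) (vv S w).
have Bge w : Ap_ball p w -> d / 2 <= B w.
  move=> hw; have [if_ _] := (ballP f).1 hf; have [iw _] := (ballP w).1 hw.
  have ht : 0 <= t <= 1 by rewrite (ltW t0).
  have /dQ := ball_convex ht hf hw.
  set ft := (fun x => _) => hd.
  have vvE S : List.In S ss -> vv S ft = ofR t * vv S w + ofR (1 - t) * vv S f.
    move=> /hss[lS _]; have i2 := proj1 (An_scale (ofR (1 - t)) if_).
    rewrite /vv (lS _ _ _ iw i2) (dualZ _ lS if_) ofRD ofRN ofR1; ring.
  have {}hd : d <= \sum_(S <- ss) (cabs (vv S f) ^+ 2 +
      2 * t * (rip (vv S f) (vv S w) - cabs (vv S f) ^+ 2) +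
      t ^+ 2 * cabs (vv S w - vv S f) ^+ 2).
    by rewrite (le_trans hd)//; apply: suml => S /vvE ->; rewrite cabs_segment.
  rewrite !big_split /= -!mulr_sumr big_split /= sumrN -/(Q f) -/(B w) in hd.
  have hL : t ^+ 2 * (\sum_(S <- ss) cabs (vv S w - vv S f) ^+ 2) <= t * (d / 2).
    rewrite expr2 -mulrA ler_pM2l//; apply: le_trans tL.
    by rewrite ler_pM2l// Lb.
  have hQ := dQ _ hf.
  move: (Q f) (B w) hd hL hQ Qf => Qf Bw hd hL hQ Qf'.
  have h1 : t * (d / 2) <= t * Bw by nra.
  by move: h1; rewrite ler_pM2l.
(* Pairing with the residual vector of [f] is, up to a real part, evaluation of the single
   functional [S0]: this is the separating hyperplane. *)
pose cs := map (fun S => (cj (vv S f), S)) ss.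
pose S0 u := \sum_(cS <- cs) cS.1 * cS.2 u.
have hcs cS : List.In cS cs -> in_Ap_dual p cS.2.
  rewrite /cs; elim: (ss) hss => [//|S s IH] h /= [<-|]; first by apply: h; left.
  by apply: IH => S' hS'; apply: h; right.
have hS0 : in_Ap_dual p S0 by exact: in_Ap_dual_sum.
have FS0 : F S0 = \sum_(cS <- cs) cS.1 * F cS.2 by exact: bidual_sum.
have BE w : B w = complex.Re (ofR M * S0 w - F S0).
  rewrite FS0 /S0 /cs !big_map mulr_sumr -sumrB Re_sum.
  by apply: eq_bigr => S _; rewrite rip_cj; congr complex.Re; rewrite /vv /=; ring.
(* The ball is stable under multiplication by [c], so [w] may be rotated to make [S0 w] real and
   non-positive. The supremum over [w] then contradicts the bound of [F] at [S0]. *)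
have S0le w : Ap_ball p w -> cabs (S0 w) <= (cabs (F S0) - d / 2) / M.
  move=> hw; have [c c1 cE] := unimodular_neg (S0 w).
  have := Bge _ (ball_scale c1 hw).
  rewrite BE (dualZ _ (proj1 hS0) (proj1 ((ballP w).1 hw))) cE.
  rewrite ReB mulrN -ofRM -ofRN Re_ofR ler_pdivlMr// => h.
  have := cabs_Re (F S0); rewrite ler_norml => /andP[h' _].
  rewrite mulrC; lra.
have := Dn_le S0le; rewrite ler_pdivlMr// => h1.
have := hM _ hS0; rewrite mulrC; lra.
Qed.

End Duals.

(** * Limits along an ultrafilter *)

Section UltraLimits.
Variables (R : realType) (U : set_system nat).
Hypotheses (UU : UltraFilter U) (ooU : \oo `<=` U).
Local Notation C := (Cx R).
Implicit Types (a b : nat -> C) (l : C).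

Definition ulim a l : Prop := forall e : R, 0 < e -> U [set n | cabs (a n - l) < e].

Let UF : ProperFilter U := @ultra_proper _ _ UU.

Lemma ulim_uniq a l l' : ulim a l -> ulim a l' -> l = l'.
Proof.
move=> h h'; apply: cabs_small_eq => e e0.
have e2 : 0 < e / 2 by rewrite divr_gt0.
have [n [/= h1 h2]] := filter_ex (filterI (h _ e2) (h' _ e2)).
have := cabs_triangle l (a n) l'; rewrite (cabs_distC l (a n)); lra.
Qed.

Lemma ulim_lin (c : C) a b l l' : ulim a l -> ulim b l' ->
  ulim (fun n => c * a n + b n) (c * l + l').
Proof.
move=> h h' e e0; have c0 := cabs_ge0 c.
have d0 : 0 < e / 2 / (cabs c + 1) by rewrite !divr_gt0// ltr_wpDl.
have e2 : 0 < e / 2 by rewrite divr_gt0.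
apply: filterS (filterI (h _ d0) (h' _ e2)) => n /= [h1 h2].
rewrite (_ : _ - _ = c * (a n - l) + (b n - l')); last by ring.
rewrite (le_lt_trans (cabsD _ _))// cabsM [ltRHS]splitr ler_ltD//.
rewrite (@le_trans _ _ (cabs c * (e / 2 / (cabs c + 1))))//.
  by rewrite ler_wpM2l// ltW.
rewrite mulrA ler_pdivrMr ?ltr_wpDl//; nra.
Qed.

Lemma ulim_cvg a l : a @ \oo --> l -> ulim a l.
Proof.
move=> /cvg_cabsP h e /h[N hN]; apply: ooU; exists N => // n /hN.
by rewrite /= cabs_distC.
Qed.

Lemma ulim_le a l (M : R) : ulim a l -> (forall n, cabs (a n) <= M) -> cabs l <= M.
Proof.
move=> h hM; apply/ler_addgt0Pr => e /h /filter_ex[n /= hn].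
have := hM n; have := cabsB (a n) (a n - l).
rewrite opprB addrC subrK => h1 h2; lra.
Qed.

(** The limit is the supremum of the levels that [x] reaches on a member of [U]. A level above it is
    not reached on a member, so the ultrafilter contains the complement. *)
Lemma real_ulim (x : nat -> R) (M : R) : (forall n, `|x n| <= M) ->
  exists l : R, forall e : R, 0 < e -> U [set n | `|x n - l| < e].
Proof.
move=> hM; pose D := [set r | U [set n | r <= x n]].
have D0 : D !=set0.
  by exists (- M); apply: filterS filterT => n _ /=; have := hM n; rewrite ler_norml => /andP[].
have Dub : has_ubound D.
  exists M => r /filter_ex[n /= h]; rewrite (le_trans h)//.
  by have := hM n; rewrite ler_norml => /andP[].
exists (sup D) => e e0.
have [r Dr rs] := sup_adherent e0 (conj D0 Dub).
have hi : U [set n | x n < sup D + e / 2].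
  have [//|h] := in_ultra_setVsetC [set n | sup D + e / 2 <= x n] UU; last first.
    by apply: filterS h => n /= /negP; rewrite -ltNge.
  move=> h; have : sup D + e / 2 <= sup D by apply: ub_le_sup.
  by rewrite gerDl leNgt divr_gt0.
apply: filterS (filterI Dr hi) => n /= [h1 h2].
rewrite ltr_norml; lra.
Qed.

Lemma ulim_ex a (M : R) : (forall n, cabs (a n) <= M) -> exists l, ulim a l.
Proof.
move=> hM.
have [x hx] := @real_ulim (fun n => complex.Re (a n)) M
  (fun n => le_trans (cabs_Re _) (hM n)).
have [y hy] := @real_ulim (fun n => complex.Im (a n)) M
  (fun n => le_trans (cabs_Im _) (hM n)).
exists (ofR x + (0 +i* 1)%C * ofR y) => e e0.
have e2 : 0 < e / 2 by rewrite divr_gt0.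
apply: filterS (filterI (hx _ e2) (hy _ e2)) => n /= [h1 h2].
rewrite (_ : a n - _ = ofR (complex.Re (a n) - x) +
    (0 +i* 1)%C * ofR (complex.Im (a n) - y)).
  rewrite (le_lt_trans (cabsD _ _))// cabsM cabs_i mul1r !cabs_ofR; lra.
by rewrite {1}(complex_decomp (a n)) !ofRD !ofRN; ring.
Qed.

(** Total, with value 0 where no limit exists, because elements of the bidual are encoded as
    functions of arbitrary functionals. *)
Definition ulv a : C := xget 0 [set l | ulim a l].

Lemma ulvE a l : ulim a l -> ulv a = l.
Proof.
move=> h; rewrite /ulv; case: xgetP => [l' -> h'|/(_ l)//].
exact: ulim_uniq h' h.
Qed.

Lemma ulvP a (M : R) : (forall n, cabs (a n) <= M) -> ulim a (ulv a).
Proof. by move=> /ulim_ex[l h]; rewrite (ulvE h). Qed.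

(** Stage [k] handles only the members of code at most [k], hence intersects finitely many sets of
    [U]. The map [s] is not claimed to be increasing; [k <= s k] is what later gives strict
    inequalities between indices. *)
Lemma diagonal_subsequence (I : countType) (a : I -> nat -> C) (l : I -> C) :
  (forall i, ulim (a i) (l i)) ->
  exists s : nat -> nat, (forall k, (k <= s k)%N) /\
    forall i, (a i \o s) @ \oo --> l i.
Proof.
move=> h.
pose good k n := forall i, (pickle i <= k)%N -> cabs (a i n - l i) < k.+1%:R^-1.
have Ugood k : U [set n | (k <= n)%N /\ good k n].
  have Uge : U [set n | (k <= n)%N] by apply: ooU; exists k.
  suff Ug j : U [set n | forall i, (pickle i <= j)%N -> cabs (a i n - l i) < k.+1%:R^-1].
    by apply: filterS (filterI Uge (Ug k)).
  have k0 : 0 < k.+1%:R^-1 :> R by rewrite invr_gt0.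
  have one j' : U [set n | forall i, pickle i = j' -> cabs (a i n - l i) < k.+1%:R^-1].
    have [[i <-]|hn] := pselect (exists i : I, pickle i = j').
      apply: filterS (h i _ k0) => n /= hi i' E.
      by rewrite (pcan_inj pickleK E).
    by apply: filterS filterT => n _ i E; exfalso; apply: hn; exists i.
  elim: j => [|j IH].
    by apply: filterS (one 0%N) => n /= hn i; rewrite leqn0 => /eqP/hn.
  apply: filterS (filterI IH (one j.+1)) => n /= [h1 h2] i.
  by rewrite leq_eqVlt => /predU1P[/h2|]//; rewrite ltnS => /h1.
have /choice[s hs] k : exists n, (k <= n)%N /\ good k n.
  by have [n hn] := filter_ex (Ugood k); exists n.
exists s; split=> [k|i]; first by case: (hs k).
apply/cvg_cabsP => e e0.
have [N _ /(_ N (leqnn N)) /= hN] := near_infty_natSinv_lt (PosNum e0).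
exists (maxn N (pickle i)) => n; rewrite geq_max => /andP[Nn pn].
rewrite cabs_distC (lt_trans (proj2 (hs n) i pn))// (le_lt_trans _ hN)//.
by rewrite lef_pV2 ?posrE// ler_nat ltnS.
Qed.

End UltraLimits.

(** * Iterated limits *)

Section IteratedLimits.
Variables (R : realType) (G : groupType) (p : R).
Hypotheses (cG : countable [set: G]) (p1 : 1 < p).
Local Notation C := (Cx R).

Let Zlim := forall (f g : nat -> G -> C) (phi : nat -> (G -> C) -> C),
  (forall n, Ap_ball p (f n)) -> (forall m, Ap_ball p (g m)) ->
  (forall k, in_Zp p (phi k)) -> forall L L' : C,
  iterlim_nmk (fun n m k => phi k (pmul (f n) (g m))) L ->
  iterlim_mnk (fun n m k => phi k (pmul (f n) (g m))) L' -> L = L'.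

Lemma ultra_oo : exists U : set_system nat, UltraFilter U /\ \oo `<=` U.
Proof. by have [U [h1 h2]] := @ultraFilterLemma nat \oo _; exists U. Qed.

Lemma ultra_bidual (U : set_system nat) (f : nat -> G -> C) : UltraFilter U ->
  (forall n, Ap_ball p (f n)) -> in_Ap_bidual p (fun T => ulv U (fun n => T (f n))).
Proof.
move=> UU hf.
have hl T : in_Ap_dual p T -> ulim U (fun n => T (f n)) (ulv U (fun n => T (f n))).
  by move=> hT; apply: (ulvP UU) => n; exact: (Dn_ball p1 hT (hf n)).
split.
- move=> a T S hT hS; apply: (ulvE UU); apply: (ulim_lin UU); exact: hl.
- move=> T S TS; congr (ulv U); apply/funext => n; apply: TS.
  by case: (hf n).
- exists 1 => T hT; rewrite mul1r -DnE; apply: (ulim_le UU) (hl _ hT) _ => n.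
  exact: (Dn_ball p1 hT (hf n)).
Qed.

Lemma Zp_bound (T : (G -> C) -> C) u : in_Zp p T -> in_Ap p u -> cabs (T u) <= An p u.
Proof.
move=> [_ [hT nT]] hu; rewrite (le_trans (Dn_bound p1 hT hu))//.
by rewrite ler_piMl ?An_ge0// DnE.
Qed.

Lemma Zp_mul_bound (T : (G -> C) -> C) u v : in_Zp p T -> Ap_ball p u -> Ap_ball p v ->
  cabs (T (pmul u v)) <= 1.
Proof.
move=> hT /ballP[hu nu] /ballP[hv nv]; have [h1 h2] := An_mul cG p1 hu hv.
rewrite (le_trans (Zp_bound hT h1))// (le_trans h2)//.
by rewrite mulr_ile1 ?An_ge0.
Qed.

Lemma regular_iterated : Ap_Arens_regular G p -> Zlim.
Proof.
move=> reg f g phi hf hg hphi L L' [b [c [hb hc hL]]] [b' [d [hb' hd hL']]].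
have [U [UU ooU]] := ultra_oo.
pose T u := ulv U (fun k => phi k u).
have hl u : in_Ap p u -> ulim U (fun k => phi k u) (T u).
  by move=> hu; apply: (ulvP UU) => k; exact: (Zp_bound (hphi k) hu).
have hT : in_Ap_dual p T.
  apply/(dualP p1); split.
    move=> a u v hu hv; apply: (ulvE UU).
    rewrite (_ : (fun k => _) = fun k => a * phi k u + phi k v).
      by apply: (ulim_lin UU); exact: hl.
    by apply/funext => k; have [_ [[lk _] _]] := hphi k; exact: lk.
  exists 1 => // u hu; rewrite mul1r; apply: (ulim_le UU) (hl _ hu) _ => k.
  exact: Zp_bound (hphi k) hu.
have Tb n m : T (pmul (f n) (g m)) = b n m.
  exact: (ulvE UU (ulim_cvg ooU (hb n m))).
have bb' n m : b n m = b' n m by exact: cvgC_uniq (hb n m) (hb' n m).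
have := reg _ _ (ultra_bidual UU hf) (ultra_bidual UU hg) T hT.
have -> : arens1 (fun T => ulv U (fun n => T (f n))) (fun T => ulv U (fun n => T (g n))) T = L.
  rewrite /arens1; apply: (ulvE UU); rewrite (_ : (fun n => _) = c).
    exact: (ulim_cvg ooU hL).
  apply/funext => n; rewrite /bidual_dual /dual_rmul; apply: (ulvE UU).
  rewrite (_ : (fun m => _) = b n); first exact: (ulim_cvg ooU (hc n)).
  by apply/funext => m; rewrite Tb.
have -> // : arens2 (fun T => ulv U (fun n => T (f n))) (fun T => ulv U (fun n => T (g n))) T = L'.
rewrite /arens2; apply: (ulvE UU); rewrite (_ : (fun n => _) = d).
  exact: (ulim_cvg ooU hL').
apply/funext => m; rewrite /dual_bidual /dual_lmul; apply: (ulvE UU).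
rewrite (_ : (fun n => _) = (fun n => b' n m)); first exact: (ulim_cvg ooU (hd m)).
by apply/funext => n; rewrite Tb bb'.
Qed.

Lemma iterated_closures : Zlim ->
  forall (f g : nat -> G -> C) (phi : nat -> (G -> C) -> C),
  (forall n, Ap_ball p (f n)) -> (forall m, Ap_ball p (g m)) ->
  (forall k, in_Zp p (phi k)) ->
  closure [set z : C | exists n m k : nat,
             [/\ (m < n)%N, (n < k)%N & z = phi k (pmul (f n) (g m))]]
  `&`
  closure [set z : C | exists n m k : nat,
             [/\ (n < m)%N, (m < k)%N & z = phi k (pmul (f n) (g m))]]
  !=set0.
Proof.
move=> hZ f g phi hf hg hphi.
have [U [UU ooU]] := ultra_oo.
pose b n m := ulv U (fun k => phi k (pmul (f n) (g m))).
have ub n m : ulim U (fun k => phi k (pmul (f n) (g m))) (b n m).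
  by apply: (ulvP UU) => k; exact: Zp_mul_bound.
have b1 n m : cabs (b n m) <= 1.
  by apply: (ulim_le UU) (ub n m) _ => k; exact: Zp_mul_bound.
pose c n := ulv U (b n); pose d m := ulv U (fun n => b n m).
have uc n : ulim U (b n) (c n) by exact: (ulvP UU (b1 n)).
have ud m : ulim U (fun n => b n m) (d m) by apply: (ulvP UU) => n; exact: b1.
have c1 n : cabs (c n) <= 1 by exact: (ulim_le UU) (uc n) (b1 n).
have d1 m : cabs (d m) <= 1 by apply: (ulim_le UU) (ud m) _ => n; exact: b1.
have uL : ulim U c (ulv U c) by exact: (ulvP UU c1).
have uL' : ulim U d (ulv U d) by exact: (ulvP UU d1).
have [t [tk ht]] := diagonal_subsequence UU ooU
  (a := fun (i : nat * nat) k => phi k (pmul (f i.1) (g i.2)))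
  (l := fun i => b i.1 i.2) (fun i => ub i.1 i.2).
(* All rows and columns of [b] and both sequences of their limits form one countable family, so a
   single [s] can reindex [n] and [m] at the same time. *)
pose fam (i : nat + nat + bool) : nat -> C := match i with
  | inl (inl n) => b n | inl (inr m) => fun n => b n m
  | inr true => c | inr false => d end.
pose lim_ (i : nat + nat + bool) : C := match i with
  | inl (inl n) => c n | inl (inr m) => d m
  | inr true => ulv U c | inr false => ulv U d end.
have [s [sk hs]] : exists s : nat -> nat, (forall k, (k <= s k)%N) /\
    forall i, (fam i \o s) @ \oo --> lim_ i.
  have hfam i : ulim U (fam i) (lim_ i).
    by case: i => [[n|m]|[]]; [exact: uc|exact: ud|exact: uL|exact: uL'].
  exact: (diagonal_subsequence UU ooU hfam).
have E : ulv U c = ulv U d.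
  apply: (hZ (f \o s) (g \o s) (phi \o t)) => [n|m|k||].
  - exact: hf.
  - exact: hg.
  - exact: hphi.
  - exists (fun n m => b (s n) (s m)), (c \o s); split.
    + by move=> n m; exact: (ht (s n, s m)).
    + by move=> n; exact: (hs (inl (inl (s n)))).
    + exact: (hs (inr true)).
  - exists (fun n m => b (s n) (s m)), (d \o s); split.
    + by move=> n m; exact: (ht (s n, s m)).
    + by move=> m; exact: (hs (inl (inr (s m)))).
    + exact: (hs (inr false)).
have three (z1 z2 z3 z4 : C) (e : R) : cabs (z1 - z2) < e / 3 -> cabs (z2 - z3) < e / 3 ->
    cabs (z3 - z4) < e / 3 -> cabs (z1 - z4) < e.
  have := cabs_triangle z1 z2 z4; have := cabs_triangle z2 z3 z4; lra.
exists (ulv U c); split; apply/closure_cabsP => e e0;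
    have e3 : 0 < e / 3 by rewrite divr_gt0.
(* For [m < n < k] the index [m] is fixed first, then [n], then [k]; the value approached this way
   is the limit of [d], equal to that of [c] by [E]. *)
- rewrite E.
  have [j1 /(_ _ (leqnn _)) h1] := (cvg_cabsP _ _).1 (hs (inr false)) _ e3.
  have [j2 h2] := (cvg_cabsP _ _).1 (hs (inl (inr (s j1)))) _ e3.
  (* Since [i <= s i], the successor forces [s j1 < n]; the map [t] plays the same role for [k]. *)
  pose n := s (maxn j2 (s j1).+1).
  have [j3 h3] := (cvg_cabsP _ _).1 (ht (n, s j1)) _ e3.
  exists (phi (t (maxn j3 n.+1)) (pmul (f n) (g (s j1)))).
    exists n, (s j1), (t (maxn j3 n.+1)); split; last by [].
    + exact: leq_trans (leq_maxr _ _) (sk _).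
    + exact: leq_trans (leq_maxr _ _) (tk _).
  exact: three h1 (h2 _ (leq_maxl _ _)) (h3 _ (leq_maxl _ _)).
- have [j1 /(_ _ (leqnn _)) h1] := (cvg_cabsP _ _).1 (hs (inr true)) _ e3.
  have [j2 h2] := (cvg_cabsP _ _).1 (hs (inl (inl (s j1)))) _ e3.
  pose m := s (maxn j2 (s j1).+1).
  have [j3 h3] := (cvg_cabsP _ _).1 (ht (s j1, m)) _ e3.
  exists (phi (t (maxn j3 m.+1)) (pmul (f (s j1)) (g m))).
    exists (s j1), m, (t (maxn j3 m.+1)); split; last by [].
    + exact: leq_trans (leq_maxr _ _) (sk _).
    + exact: leq_trans (leq_maxr _ _) (tk _).
  exact: three h1 (h2 _ (leq_maxl _ _)) (h3 _ (leq_maxl _ _)).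
Qed.

End IteratedLimits.

(** * A sandwich theorem for sublinear functionals *)

Section MazurOrlicz.
Variables (R : realType) (V : lmodType R) (D : V -> Prop).
Hypotheses (D0 : D 0) (Dlin : forall (a : R) v w, D v -> D w -> D (a *: v + w)).
Implicit Types (f : V -> R) (v w x y : V).

Let DD v w : D v -> D w -> D (v + w).
Proof. by move=> hv hw; have := Dlin 1 hv hw; rewrite scale1r. Qed.

Let DZ (a : R) v : D v -> D (a *: v).
Proof. by move=> hv; have := Dlin a hv D0; rewrite addr0. Qed.

Let DN v : D v -> D (- v).
Proof. by move=> /(DZ (-1)); rewrite scaleN1r. Qed.

(** Restricted to [D] because [l1norm] is the real part of a possibly infinite sum, and is 0 when
    the sum is infinite: it is sublinear on finitely supported functions but in general not on all
    functions. *)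
Definition sublin f : Prop :=
  (forall v w, D v -> D w -> f (v + w) <= f v + f w) /\
  (forall (t : R) v, 0 <= t -> D v -> f (t *: v) <= t * f v).

Lemma sublin0 f : sublin f -> f 0 = 0.
Proof.
move=> [fD fZ]; apply/eqP; rewrite eq_le; apply/andP; split.
  by have := fZ 0 0 (lexx _) D0; rewrite scale0r mul0r.
by have := fD 0 0 D0 D0; rewrite addr0; lra.
Qed.

Lemma sublinN f v : sublin f -> D v -> - f (- v) <= f v.
Proof.
move=> sf hv; have [fD _] := sf; have := fD _ _ hv (DN hv).
by rewrite subrr sublin0//; lra.
Qed.

Lemma sublinZ f (t : R) v : sublin f -> 0 <= t -> D v -> f (t *: v) = t * f v.
Proof.
move=> sf; rewrite le_eqVlt => /predU1P[<-|t0] hv.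
  by rewrite scale0r mul0r sublin0.
have [_ fZ] := sf; apply/eqP; rewrite eq_le; apply/andP; split.
  exact: fZ (ltW t0) hv.
have := fZ t^-1 _ (ltac:(by rewrite invr_ge0 ltW)) (DZ t hv).
by rewrite scalerA mulVf ?gt_eqF// scale1r ler_pdivlMl.
Qed.

Definition shift_set f (K : set V) (d : R) x : set R :=
  [set r | exists (t : R) k, [/\ 0 <= t, K k & r = f (x + t *: k) - t * d]].

(** Take the infimum of [shift_set]. An additive odd functional below it is at least [d] on [K],
    since its value at -k is at most -d: the lower bound on [K] is absorbed into the upper bound. *)
Lemma sublin_shift f (K : set V) (d : R) : sublin f ->
  K !=set0 -> (forall k, K k -> D k) ->
  (forall (t : R) k l, 0 <= t <= 1 -> K k -> K l -> K (t *: k + (1 - t) *: l)) ->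
  (forall k, K k -> d <= f k) ->
  exists f', [/\ sublin f', forall x, D x -> f' x <= f x &
                 forall k, K k -> f' (- k) <= - d].
Proof.
move=> sf [k0 Kk0] KD Kconv dK; have [fD fZ] := sf.
(* t d <= t f(k) = f(t k) <= f(x + t k) + f(-x), so the infimum is finite. *)
have lb x : D x -> lbound (shift_set f K d x) (- f (- x)).
  move=> hx _ [t [k [t0 Kk ->]]]; have hk := KD _ Kk.
  have h1 := fD _ _ (DD hx (DZ t hk)) (DN hx).
  rewrite addrAC subrr add0r (sublinZ sf t0 hk) in h1.
  have := dK _ Kk; nra.
have ne x : shift_set f K d x !=set0 by exists (f (x + 0 *: k0) - 0 * d), 0, k0.
pose f' x := inf (shift_set f K d x).
have f'le x (t : R) k : D x -> 0 <= t -> K k -> f' x <= f (x + t *: k) - t * d.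
  move=> hx t0 Kk; apply: ge_inf; first by exists (- f (- x)); exact: lb.
  by exists t, k.
have f'ge x (r : R) : D x ->
    (forall (t : R) k, 0 <= t -> K k -> r <= f (x + t *: k) - t * d) -> r <= f' x.
  by move=> hx h; apply: lb_le_inf => // _ [t [k [t0 Kk ->]]]; exact: h.
exists f'; split.
- split=> [x y hx hy|s x s0 hx].
    rewrite -lerBlDr; apply: (f'ge) => // t k t0 Kk.
    rewrite lerBlDr -lerBlDl; apply: (f'ge) => // s l s0 Kl; rewrite lerBlDr.
    (* Convexity of [K] merges the two shifts into one, which gives subadditivity; t + s = 0 allows
       no division but any point of [K] will do. *)
    have [m Km E] : exists2 m, K m & (t + s) *: m = t *: k + s *: l.
      have [ts0|ts0] := eqVneq (t + s) 0.
        have -> : t = 0 by lra.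
        have -> : s = 0 by lra.
        by exists k; rewrite // addr0 !scale0r addr0.
      have tsp : 0 < t + s by rewrite lt_def ts0 addr_ge0.
      exists ((t / (t + s)) *: k + (1 - t / (t + s)) *: l).
        apply: Kconv => //; rewrite divr_ge0 ?(ltW tsp)//=.
        by rewrite ler_pdivrMr// mul1r lerDl.
      rewrite scalerDr !scalerA mulrBr mulr1 mulrC divfK// [t + s]addrC addrK.
      by [].
    have h1 := @f'le (x + y) (t + s) m (DD hx hy) (addr_ge0 t0 s0) Km.
    have h2 := fD _ _ (DD hx (DZ t (KD _ Kk))) (DD hy (DZ s (KD _ Kl))).
    rewrite addrACA -E in h2; rewrite (le_trans h1)//; lra.
  move: s0; rewrite le_eqVlt => /predU1P[<-|s0].
    rewrite scale0r mul0r.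
    by have := @f'le 0 0 k0 D0 (lexx _) Kk0; rewrite scale0r addr0 mul0r subr0 (sublin0 sf).
  rewrite -ler_pdivrMl//; apply: (f'ge) => // t k t0 Kk; rewrite ler_pdivrMl//.
  have := @f'le (s *: x) (s * t) k (DZ s hx) (mulr_ge0 (ltW s0) t0) Kk.
  rewrite -scalerA -scalerDr (sublinZ sf (ltW s0)) ?mulrBr ?mulrA//.
  exact: DD hx (DZ t (KD _ Kk)).
- move=> x hx; have := @f'le x 0 k0 hx (lexx _) Kk0.
  by rewrite scale0r addr0 mul0r subr0.
- move=> k Kk; have := @f'le (- k) 1 k (DN (KD _ Kk)) ler01 Kk.
  by rewrite scale1r addNr sublin0// mul1r sub0r.
Qed.

(** Zorn's lemma for the reversed pointwise order on [D]. A chain is bounded by its pointwise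
    infimum, finite because every sublinear functional below [f] is at least -f(-x) at [x]. *)
Lemma sublin_minimal f : sublin f ->
  exists g, [/\ sublin g, forall x, D x -> g x <= f x &
    forall h, sublin h -> (forall x, D x -> h x <= g x) -> forall x, D x -> g x <= h x].
Proof.
move=> sf.
pose T := {g | sublin g /\ forall x, D x -> g x <= f x}.
have t0 : T by exists f.
pose rel_ (s t : T) := `[< forall x, D x -> sval t x <= sval s x >].
have [||A totA|[g [sg gf]] gmin] := @ZL_preorder T t0 rel_.
- by move=> t; apply/asboolP.
- move=> r s t /asboolP h1 /asboolP h2; apply/asboolP => x hx.
  exact: le_trans (h2 _ hx) (h1 _ hx).
- have [->|/set0P[a0 Aa0]] := eqVneq A set0; first by exists t0.
  pose S x : set R := [set r | exists2 t : T, A t & r = sval t x].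
  have lb x : D x -> lbound (S x) (- f (- x)).
    move=> hx _ [[t [st tf]] At ->] /=.
    apply: le_trans (sublinN st hx); rewrite lerN2; exact: tf (DN hx).
  have ne x : S x !=set0 by exists (sval a0 x), a0.
  pose m x := inf (S x).
  have mle x t : D x -> A t -> m x <= sval t x.
    move=> hx At; apply: ge_inf; first by exists (- f (- x)); exact: lb.
    by exists t.
  have mge x (r : R) : D x -> (forall t, A t -> r <= sval t x) -> r <= m x.
    by move=> hx h; apply: lb_le_inf => // _ [t At ->]; exact: h.
  have sm : sublin m.
    split=> [x y hx hy|s x s0 hx].
      rewrite -lerBlDr; apply: (mge) => // t At.
      rewrite lerBlDr -lerBlDl; apply: (mge) => // s As; rewrite lerBlDr.
      have [[tD _] _] := svalP t; have [[sD _] _] := svalP s.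
      (* The members chosen for [x] and for [y] are comparable, and the smaller one serves both
         arguments. *)
      have [/asboolP h|/asboolP h] := totA _ _ At As.
        rewrite (le_trans (mle _ _ (DD hx hy) As))// (le_trans (sD _ _ hx hy))//.
        by have := h _ hx; lra.
      rewrite (le_trans (mle _ _ (DD hx hy) At))// (le_trans (tD _ _ hx hy))//.
      by have := h _ hy; lra.
    move: s0; rewrite le_eqVlt => /predU1P[<-|s0].
      rewrite scale0r mul0r; have [st _] := svalP a0.
      by have := mle _ _ D0 Aa0; rewrite (sublin0 st).
    rewrite -ler_pdivrMl//; apply: (mge) => // t At; rewrite ler_pdivrMl//.
    by have [st _] := svalP t; rewrite -(sublinZ st (ltW s0) hx) mle//; exact: DZ.
  have mf x : D x -> m x <= f x.
    by move=> hx; rewrite (le_trans (mle _ _ hx Aa0))//; have [_] := svalP a0; apply.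
  exists (exist _ m (conj sm mf)) => s As; apply/asboolP => x hx /=; exact: mle.
- exists g; split=> // h sh hg x hx.
  have hf y : D y -> h y <= f y by move=> hy; exact: le_trans (hg _ hy) (gf _ hy).
  have /asboolP/(_ x hx) := gmin (exist _ h (conj sh hf)) (ltac:(by apply/asboolP)).
  by [].
Qed.

Lemma mazur_orlicz f (K : set V) (d : R) : sublin f ->
  K !=set0 -> (forall k, K k -> D k) ->
  (forall (t : R) k l, 0 <= t <= 1 -> K k -> K l -> K (t *: k + (1 - t) *: l)) ->
  (forall k, K k -> d <= f k) ->
  exists g : V -> R, [/\ forall v w, D v -> D w -> g (v + w) = g v + g w,
    forall v, D v -> g (- v) = - g v, forall v, D v -> g v <= f v &
    forall k, K k -> d <= g k].
Proof.
move=> sf Kne KD Kconv dK.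
have [f' [sf' f'f f'K]] := sublin_shift sf Kne KD Kconv dK.
have [g [sg gf' gmin]] := sublin_minimal sf'.
have gN v : D v -> g (- v) = - g v.
  move=> hv; apply/eqP; rewrite eq_le; apply/andP; split; last first.
    by have := sublinN sg (DN hv); rewrite opprK.
  (* Shifting [g] by the singleton of [v] at level [g v] gives a functional below [g]; minimality
     makes it no smaller, so its bound at -v passes to [g]. Oddness then upgrades subadditivity to
     additivity. *)
  have [h [sh hg hK]] : exists h, [/\ sublin h, forall x, D x -> h x <= g x &
      forall k, [set v] k -> h (- k) <= - g v].
    apply: sublin_shift => //.
    - by exists v.
    - by move=> k ->.
    - by move=> t k l _ -> ->; rewrite /= -scalerDl addrC subrK scale1r.
    - by move=> k ->.
  exact: le_trans (gmin _ sh hg _ (DN hv)) (hK v erefl).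
exists g; split=> //.
- move=> v w hv hw; have [gD _] := sg; apply/eqP; rewrite eq_le gD//=.
  have := gD _ _ (DD hv hw) (DN hw); rewrite addrK gN//; lra.
- by move=> v hv; exact: le_trans (gf' _ hv) (f'f _ hv).
- move=> k Kk; have := le_trans (gf' _ (DN (KD _ Kk))) (f'K _ Kk).
  by rewrite gN ?lerN2//; exact: KD.
Qed.

End MazurOrlicz.

(** * Reiter's condition *)

Section Reiter.
Variables (R : realType) (G : groupType).

Definition rfsupp (J : choiceType) (v : J -> R) : Prop :=
  exists s : seq J, forall j, j \notin s -> v j = 0.

Lemma rfsupp_lin (J : choiceType) (a : R) (v w : J -> R) : rfsupp v -> rfsupp w ->
  rfsupp (fun j => a * v j + w j).
Proof.
move=> [s hs] [s' hs']; exists (s ++ s') => x; rewrite mem_cat negb_or.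
by move=> /andP[/hs -> /hs' ->]; rewrite mulr0 addr0.
Qed.

Lemma rfsupp_summ (J : choiceType) (v : J -> R) : rfsupp v -> summ (fun j => `|v j|).
Proof.
move=> [s hs]; have [||h _] := @summ_finite R J (undup s) (fun j => `|v j|) (undup_uniq s).
- by move=> j; exact: normr_ge0.
- by move=> j; rewrite mem_undup => /hs ->; rewrite normr0.
- exact: h.
Qed.

Definition l1norm (J : choiceType) (v : J -> R) : R := rsum (fun j => `|v j|).

Lemma l1norm_sublin (J : choiceType) :
  @sublin R (J -> R^o) (@rfsupp J) (@l1norm J).
Proof.
split=> [v w hv hw|t v t0 hv]; rewrite /l1norm.
  have sv := rfsupp_summ hv; have sw := rfsupp_summ hw.
  have [s <-] := summD sv sw; apply: (proj2 (summ_le _ s)) => j.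
  by rewrite normr_ge0 ler_normD.
have sv := rfsupp_summ hv; have [_ <-] := summZ t0 sv.
rewrite le_eqVlt; apply/orP; left; apply/eqP; congr rsum; apply/funext => j.
by rewrite (_ : (t *: v) j = t * v j)// normrM ger0_norm.
Qed.

Definition prob (mu : G -> R) : Prop :=
  [/\ forall x, 0 <= mu x, rfsupp mu & rsum mu = 1].

Definition point (J : choiceType) (j : J) : J -> R := fun i => if i == j then 1 else 0.

Lemma point_rfsupp (J : choiceType) (j : J) : rfsupp (point j).
Proof. by exists [:: j] => i; rewrite inE /point => /negbTE ->. Qed.

Lemma l1norm_point (J : choiceType) (j : J) : l1norm (point j) = 1.
Proof.
have [|i|_ h] := @summ_finite R J [:: j] (fun i => `|point j i|) isT.
- by move=> i; exact: normr_ge0.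
- by rewrite inE /point => /negbTE ->; rewrite normr0.
- by rewrite /l1norm h big_seq1 /point eqxx normr1.
Qed.

Lemma prob_point y : prob (point y).
Proof.
have p0 i : 0 <= point y i by rewrite /point; case: ifP.
split=> //; first exact: point_rfsupp.
rewrite -[RHS](l1norm_point y); congr rsum; apply/funext => i.
by rewrite ger0_norm.
Qed.

Lemma prob_convex (t : R) mu nu : 0 <= t <= 1 -> prob mu -> prob nu ->
  prob (fun x => t * mu x + (1 - t) * nu x).
Proof.
move=> /andP[t0 t1] [m0 ms m1] [n0 ns n1].
have t1' : 0 <= 1 - t by rewrite subr_ge0.
have summ_prob (f : G -> R) : (forall x, 0 <= f x) -> rfsupp f -> summ f.
  move=> f0 /rfsupp_summ; rewrite (_ : (fun j => `|f j|) = f)//.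
  by apply/funext => x; rewrite ger0_norm.
have [s1 e1] := summZ t0 (summ_prob _ m0 ms).
have [s2 e2] := summZ t1' (summ_prob _ n0 ns).
split.
- by move=> x; rewrite addr_ge0 ?mulr_ge0.
- apply: rfsupp_lin => //.
  have := rfsupp_lin (1 - t) ns (ex_intro _ [::] (fun _ _ => erefl)).
  by under eq_fun do rewrite addr0.
- by rewrite (proj2 (summD s1 s2)) e1 e2 m1 n1 !mulr1 addrC subrK.
Qed.

(** The translation differences of [mu] by all elements of [E], side by side in one vector that is
    linear in [mu]; its l1 norm bounds each of them. *)
Definition diffs (E : seq G) (mu : G -> R) : G * G -> R :=
  fun k => if k.1 \in E then mu (k.1^-1 * k.2)%g - mu k.2 else 0.

Lemma diffs_rfsupp E mu : rfsupp mu -> rfsupp (diffs E mu).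
Proof.
move=> [s hs]; exists ([seq (x, (x * y)%g) | x <- E, y <- s] ++ [seq (x, y) | x <- E, y <- s]).
move=> [x z]; rewrite mem_cat negb_or => /andP[h1 h2]; rewrite /diffs /=.
case: ifP => // xE; rewrite !hs ?subr0//.
- by apply: contra h2 => zs; apply/allpairsP; exists (x, z).
- apply: contra h1 => zs; apply/allpairsP; exists (x, (x^-1 * z)%g); split=> //=.
  by rewrite mulgA mulgV mul1g.
Qed.

Lemma diffs_point E y : uniq E ->
  diffs E (point y) = fun k => \sum_(x <- E) (point (x, (x * y)%g) k - point (x, y) k).
Proof.
move=> uE; apply/funext => -[x0 z]; rewrite /diffs /=.
have other x : x != x0 -> point (x, (x * y)%g) (x0, z) - point (x, y) (x0, z) = 0 :> R.
  move=> /negbTE xx0; rewrite /point !xpair_eqE eq_sym xx0 /= subr0.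
  by [].
case: ifP => x0E.
  rewrite (bigD1_seq x0)//= big1 ?addr0; last by move=> x; exact: other.
  rewrite /point !xpair_eqE eqxx /=.
  suff -> : ((x0^-1 * z)%g == y) = (z == (x0 * y)%g) by [].
  apply/eqP/eqP => [<-|->]; first by rewrite mulgA mulgV mul1g.
  by rewrite mulgA mulVg mul1g.
rewrite big_seq big1// => x xE; apply: other.
by apply: contraFN x0E => /eqP <-.
Qed.

Lemma additive_sum (J : choiceType) (g : (J -> R^o) -> R) (I : Type) (E : seq I)
    (F : I -> J -> R^o) :
  (forall v w, rfsupp v -> rfsupp w -> g (v + w) = g v + g w) ->
  (forall i, rfsupp (F i)) ->
  g (fun k => \sum_(i <- E) F i k) = \sum_(i <- E) g (F i).
Proof.
move=> gD hF.
have hs (s : seq I) : rfsupp (fun k => \sum_(i <- s) F i k).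
  elim: s => [|i s IH]; first by exists [::] => k _; rewrite big_nil.
  under eq_fun do rewrite big_cons -[F i _]mul1r.
  exact: rfsupp_lin.
elim: E => [|i s IH].
  under eq_fun do rewrite big_nil; rewrite big_nil.
  have r0 : @rfsupp J (0 : J -> R^o) by exists [::].
  have := gD 0 0 r0 r0; rewrite addr0 => /eqP.
  by rewrite -subr_eq0 opprD addrA subrr sub0r oppr_eq0 => /eqP.
under eq_fun do rewrite big_cons; rewrite big_cons -IH.
exact: gD.
Qed.

Lemma mean_sum (m : (G -> R) -> R) (I : Type) (E : seq I) (F : I -> G -> R) :
  (forall (a : R) f h, Defs.bounded_fun f -> Defs.bounded_fun h ->
    m (fun x => a * f x + h x) = a * m f + m h) ->
  (forall i, Defs.bounded_fun (F i)) ->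
  Defs.bounded_fun (fun x => \sum_(i <- E) F i x) /\
  m (fun x => \sum_(i <- E) F i x) = \sum_(i <- E) m (F i).
Proof.
move=> ml hF.
have b0 : Defs.bounded_fun (fun _ : G => 0 : R) by exists 0 => x; rewrite normr0.
have m0 : m (fun=> 0) = 0.
  have := ml 1 _ _ b0 b0; under [X in m X]eq_fun do rewrite mulr0 addr0.
  by rewrite mul1r => /eqP; rewrite -subr_eq0 opprD addrA subrr sub0r oppr_eq0 => /eqP.
elim: E => [|i s [bs IH]].
  by under [X in m X]eq_fun do rewrite big_nil; under eq_fun do rewrite big_nil;
     rewrite big_nil.
have [M hM] := hF i; have [N hN] := bs; split.
  by exists (M + N) => x; rewrite big_cons (le_trans (ler_normD _ _))// lerD.
under eq_fun do rewrite big_cons -[F i _]mul1r.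
by rewrite ml// IH mul1r big_cons.
Qed.

(* Day's trick: if no finitely supported probability were almost invariant, the
   sandwich theorem would give bounded functions contradicting the mean. *)
Lemma reiter (E : seq G) (e : R) : amenable R G -> 0 < e -> uniq E ->
  exists2 mu, prob mu & l1norm (diffs E mu) < e.
Proof.
move=> [m [ml mpos m1 minv]] e0 uE; apply: contrapT => hno.
pose K : set (G * G -> R^o) := [set v | exists2 mu, prob mu & v = diffs E mu].
have [] := @mazur_orlicz R (G * G -> R^o) (@rfsupp (G * G)%type) _ _ (@l1norm (G * G)%type) K e.
- by exists [::].
- by move=> a v w; exact: rfsupp_lin.
- exact: l1norm_sublin.
- by exists (diffs E (point 1%g)), (point 1%g) => //; exact: prob_point.
- by move=> _ [mu [_ h _] ->]; exact: diffs_rfsupp.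
- move=> t _ _ ht [mu hmu ->] [nu hnu ->].
  exists (fun x => t * mu x + (1 - t) * nu x); first exact: prob_convex.
  apply/funext => k; transitivity (t * diffs E mu k + (1 - t) * diffs E nu k) => //.
  by rewrite /diffs; case: ifP => _; rewrite ?mulr0 ?addr0//; ring.
- move=> _ [mu hmu ->]; rewrite leNgt; apply/negP => h; apply: hno.
  by exists mu.
move=> g [gD gN gf gK].
(* On finite sums of point masses [g] is integration against [a], a function bounded by 1 because
   [g] lies below the l1 norm. *)
pose a (k : G * G) := g (point k).
have a1 k : `|a k| <= 1.
  have hp := point_rfsupp k; rewrite ler_norml lerNl -(gN _ hp).
  rewrite -(l1norm_point k) (gf _ hp) andbT.
  rewrite (le_trans (gf _ _))//.
    have := rfsupp_lin (-1) hp (ex_intro _ [::] (fun _ _ => erefl)).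
    by under eq_fun do rewrite addr0 mulN1r.
  by rewrite /l1norm; under eq_fun do rewrite normrN.
(* The lower bound on [K], read at the point mass at [y], whose translate by [x] is the point mass
   at [x y]. *)
have hy y : e <= \sum_(x <- E) (a (x, (x * y)%g) - a (x, y)).
  have := gK (diffs E (point y)) (ltac:(by exists (point y); first exact: prob_point)).
  rewrite diffs_point// additive_sum//; last first.
    move=> x; have := rfsupp_lin (-1) (point_rfsupp (x, y)) (point_rfsupp (x, (x * y)%g)).
    by under eq_fun do rewrite mulN1r addrC.
  move=> h; rewrite (le_trans h)// le_eqVlt; apply/orP; left; apply/eqP.
  apply: eq_bigr => x _; have r1 := point_rfsupp (x, y).
  rewrite -(gN _ r1) -gD//; first exact: point_rfsupp.
  have := rfsupp_lin (-1) r1 (ex_intro _ [::] (fun _ _ => erefl)).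
  by under eq_fun do rewrite addr0 mulN1r.
have bx x : Defs.bounded_fun (fun y => a (x, (x * y)%g) - a (x, y)).
  exists (1 + 1) => y; rewrite (le_trans (ler_normB _ _))// lerD//; exact: a1.
have ba x : Defs.bounded_fun (fun y => a (x, y)) by exists 1 => y; exact: a1.
have ba' x : Defs.bounded_fun (fun y => a (x, (x * y)%g)) by exists 1 => y; exact: a1.
have [bs ms] := mean_sum E ml bx.
(* Invariance cancels the two terms for each [x]. Since [hy] bounds the same function below by [e],
   positivity of the mean and its value 1 at the constant 1 will give [e <= 0]. *)
have ms0 : m (fun y => \sum_(x <- E) (a (x, (x * y)%g) - a (x, y))) = 0.
  rewrite ms big1// => x _.
  have := ml (-1) _ _ (ba x) (ba' x).
  under [X in m X]eq_fun do rewrite mulN1r addrC.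
  by move=> ->; rewrite (minv _ x (ba x)) mulN1r addNr.
have b1 : Defs.bounded_fun (fun _ : G => 1 : R) by exists 1 => y; rewrite normr1.
have be : Defs.bounded_fun (fun y => - e * 1 + \sum_(x <- E) (a (x, (x * y)%g) - a (x, y))).
  have [M hM] := bs; exists (`|- e * 1| + M) => y.
  by rewrite (le_trans (ler_normD _ _))// lerD2l.
have := mpos _ be (fun y => ltac:(by rewrite mulr1 addrC subr_ge0)).
by rewrite ml// ms0 m1 mulr1 addr0 oppr_ge0 leNgt e0.
Qed.

End Reiter.

(** * Approximation by finitely supported functionals *)

Section ApproximateIdentity.
Variables (R : realType) (G : groupType) (p : R).
Hypotheses (cG : countable [set: G]) (p1 : 1 < p) (aG : amenable R G).
Local Notation C := (Cx R).
Local Notation q := (conj_exp p).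
Implicit Types (u v : G -> C) (T : (G -> C) -> C).

Let p0 : 0 < p. Proof. by rewrite (lt_trans ltr01). Qed.
Let q0 : 0 < q. Proof. by rewrite (lt_trans ltr01)// conj_exp_gt1. Qed.
Let pq := conj_expV p1.

(** Both terms are fractions of s + t, and a fraction in [0, 1] does not increase when raised to a
    power p > 1. *)
Lemma powR_superadd (s t : R) : 0 <= s -> 0 <= t -> s `^ p + t `^ p <= (s + t) `^ p.
Proof.
move=> s0 t0; have [st|n0] := eqVneq (s + t) 0.
  have E1 : s = 0 by lra.
  have E2 : t = 0 by lra.
  by rewrite E1 E2 addr0 powR0 ?gt_eqF// addr0.
have pos : 0 < s + t by rewrite lt_def n0 addr_ge0.
have key (x : R) : 0 <= x -> x <= s + t -> x `^ p <= x / (s + t) * (s + t) `^ p.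
  move=> x0 xst; have y0 : 0 <= x / (s + t) by rewrite divr_ge0// ltW.
  have y1 : x / (s + t) <= 1 by rewrite ler_pdivrMr// mul1r.
  rewrite -{1}(divfK n0 x) powRM// ?(ltW pos)// ler_wpM2r ?powR_ge0//.
  move: y0; rewrite le_eqVlt => /predU1P[<-|y0]; first by rewrite powR0 ?gt_eqF.
  by apply: ge1r_powR; rewrite ?y0 ?y1 ?(ltW p1).
have h1 := key s s0 (ltac:(by rewrite lerDl)).
have h2 := key t t0 (ltac:(by rewrite lerDr)).
by rewrite (le_trans (lerD h1 h2))// -mulrDl -mulrDl divff// mul1r.
Qed.

(** Superadditivity for the smaller root and the difference of the roots. It turns almost invariance
    of mu in l1 into almost invariance of mu^(1/p) in lp. *)
Lemma powR_root_dist (s t : R) : 0 <= s -> 0 <= t ->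
  `|s `^ p^-1 - t `^ p^-1| `^ p <= `|s - t|.
Proof.
wlog ts : s t / t <= s => [h s0 t0|s0 t0].
  have [/h|/ltW st] := leP t s; first exact.
  by rewrite distrC (distrC s); exact: h.
have rts : t `^ p^-1 <= s `^ p^-1.
  by apply: ge0_ler_powR; rewrite ?nnegrE ?invr_ge0 ?(ltW p0).
rewrite !ger0_norm ?subr_ge0//.
have r0 : 0 <= s `^ p^-1 - t `^ p^-1 by rewrite subr_ge0.
have := powR_superadd r0 (powR_ge0 t p^-1).
rewrite subrK (powR_invK s0 (lt0r_neq0 p0)) (powR_invK t0 (lt0r_neq0 p0)).
lra.
Qed.

Lemma approximate_unit (E : seq G) (e : R) : 0 < e ->
  exists2 v, fsupp v & Ap_ball p v /\ forall x, x \in E -> cabs (v x - 1) < e.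
Proof.
move=> e0.
(* The threshold is e^p because the l1 norm of the differences will bound the p-th power of an lp
   norm. *)
have [mu [m0 ms m1] hmu] := reiter aG (powR_gt0 p e0) (undup_uniq E).
have smu : summ mu.
  have := rfsupp_summ ms; rewrite (_ : (fun j => `|mu j|) = mu)//.
  by apply/funext => x; rewrite ger0_norm.
(* These have norm 1 in lp and lq, and eta xi = mu has sum 1. Hence v(x) - 1 is the pairing of [eta]
   with the difference between [xi] and its translate. *)
pose xi y : C := ofR (mu y `^ p^-1); pose eta y : C := ofR (mu y `^ q^-1).
have xiE : (fun y => cabs (xi y) `^ p) = mu.
  apply/funext => y; rewrite /xi cabs_ofR ger0_norm ?powR_ge0//.
  by rewrite powR_invK// gt_eqF.
have etaE : (fun y => cabs (eta y) `^ q) = mu.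
  apply/funext => y; rewrite /eta cabs_ofR ger0_norm ?powR_ge0//.
  by rewrite powR_invK// gt_eqF.
have lxi : in_lp p xi by apply/in_lpP; rewrite xiE.
have leta : in_lp q eta by apply/in_lpP; rewrite etaE.
have nxi : nrm p xi = 1 by rewrite nrm_rsum xiE m1 powR1.
have neta : nrm q eta = 1 by rewrite nrm_rsum etaE m1 powR1.
have rt0 (r : R) : 0 < r -> 0 `^ r^-1 = 0 :> R.
  by move=> r0; rewrite powR0// invr_neq0// gt_eqF.
exists (Defs.conv eta (check xi)).
  have [s hs] := ms; apply: conv_fsupp; exists s => x /hs h.
  - by rewrite /xi h rt0.
  - by rewrite /eta h rt0.
have [iv nv] := Ap_conv p1 lxi leta; rewrite nxi neta mulr1 in nv.
split; first by split.
move=> x xE; have [s1 _] := kernel_summ p0 q0 pq x lxi leta.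
have [s2 _] := lp_pairing p0 q0 pq lxi leta.
have E1 : csum (fun y => eta y * xi y) = 1.
  rewrite -ofR1 -m1 -csum_nonneg//; congr csum; apply/funext => y.
  rewrite /eta /xi -ofRM; congr ofR.
  have [->|my] := eqVneq (mu y) 0; first by rewrite !rt0// mulr0.
  rewrite -powRD; last by rewrite my implybT.
  by rewrite addrC pq powRr1.
pose dxi y := xi (x^-1 * y)%g - xi y.
have dle y : cabs (dxi y) `^ p <= `|diffs (undup E) mu (x, y)|.
  rewrite /dxi /xi -ofRN -ofRD cabs_ofR /diffs /= mem_undup xE.
  exact: powR_root_dist.
have sd := rfsupp_summ (diffs_rfsupp (undup E) ms).
have [sdx sdo sde] := summ_pair sd.
have dle' y : 0 <= cabs (dxi y) `^ p <= `|diffs (undup E) mu (x, y)|.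
  by rewrite powR_ge0 dle.
have [sp lp_le] := summ_le dle' (sdx x).
have ldxi : in_lp p dxi by apply/in_lpP.
have ndxi : nrm p dxi < e.
  rewrite nrm_rsum -(powR_Kinv (ltW e0) (lt0r_neq0 p0)).
  apply: gt0_ltr_powR; rewrite ?invr_gt0 ?nnegrE ?powR_ge0//.
    by apply: rsum_ge0 => y; exact: powR_ge0.
  apply: le_lt_trans hmu; apply: le_trans lp_le _.
  rewrite /l1norm sde.
  exact: (le_rsum1 x sdo).
have [s3 h3] := lp_pairing p0 q0 pq ldxi leta.
rewrite convE -E1.
rewrite (_ : _ - _ = csum (fun y => eta y * dxi y)).
  by rewrite (le_lt_trans (cabs_csum s3))// (le_lt_trans h3)// neta mulr1.
apply/eqP; rewrite subr_eq -(proj2 (csumD s3 s2)); apply/eqP; congr csum.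
by apply/funext => y; rewrite -mulrDr subrK.
Qed.

Lemma fsupp_dlt (s : seq G) u : uniq s -> (forall x, x \notin s -> u x = 0) ->
  in_Ap p u /\ forall T, in_Ap_dual p T -> T u = \sum_(x <- s) u x * T (dlt R x).
Proof.
elim: s u => [|a s IH] u /=.
  move=> _ hu; have -> : u = fun=> 0 by apply/funext => x; exact: hu.
  split; first exact: (proj1 (Ap0 G p1)).
  by move=> T [lT _]; rewrite big_nil (dual0 p1 lT).
move=> /andP[as_ us] hu.
pose u' x := if x == a then 0 else u x.
have [|iu' Tu'] := IH u' us.
  move=> x xs; rewrite /u'; have [//|xa] := eqVneq x a.
  by apply: hu; rewrite inE negb_or xa.
have [ia _] := Ap_dlt p1 a.
have E : u = fun x => u a * dlt R a x + u' x.
  apply/funext => x; rewrite /dlt /u'; case: eqVneq => [->|_].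
    by rewrite mulr1 addr0.
  by rewrite mulr0 add0r.
split; first by rewrite E; exact: (in_Ap_lin p1).
move=> T hT; have [lT _] := hT; rewrite {1}E lT// Tu'// big_cons; congr (_ + _).
apply: eq_big_seq => x xs; rewrite /u'; case: eqVneq => [xa|//].
by move: as_; rewrite -xa xs.
Qed.

(** The arithmetic of [approximate_unit_dual]: [D] is the norm of [T], [N] the error of the finitely
    supported approximant and [W] the sum of the moduli of its values. Each [c] is at most e/4; the
    [+ 1] terms avoid zero denominators. *)
Lemma unit_error (D W N e c1 c2 c3 : R) : 0 <= D -> 0 <= W -> 0 <= N -> 0 < e ->
  c1 <= D * N -> c2 <= D * N -> c3 <= e / (4 * (D + 1) * (W + 1)) * W * D ->
  N < e / (4 * (D + 1)) -> c1 + c2 + c3 < e.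
Proof.
move=> D0 W0 N0 e0 b1 b2 b3 nuh.
have DD : 0 < 4 * (D + 1) by lra.
have h1 : D * N <= e / 4.
  have : (4 * (D + 1)) * N < e by rewrite mulrC -ltr_pdivlMr.
  nra.
have h2 : e / (4 * (D + 1) * (W + 1)) * W * D <= e / 4.
  rewrite -mulrA mulrAC ler_pdivrMr ?mulr_gt0 ?ltr_wpDl//.
  have : W * D <= (D + 1) * (W + 1) by nra.
  nra.
lra.
Qed.

Lemma approximate_unit_dual T u (e : R) : in_Ap_dual p T -> in_Ap p u -> 0 < e ->
  exists (E : seq G) (d : R), 0 < d /\ forall v, fsupp v -> Ap_ball p v ->
    (forall x, x \in E -> cabs (v x - 1) < d) -> cabs (T (pmul v u) - T u) < e.
Proof.
move=> hT hu e0; have [lT _] := hT; have D0 := Dn_ge0 p1 hT.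
have [h0 [s0 hs0] [iuh]] := Ap_dense p1 hu
  (ltac:(by rewrite divr_gt0// mulr_gt0// ltr_wpDl) : 0 < e / (4 * (Dn p T + 1))).
rewrite -AnE => nuh.
pose s := undup s0; have us : uniq s by exact: undup_uniq.
have hs x : x \notin s -> h0 x = 0 by rewrite mem_undup; exact: hs0.
pose W := \sum_(x <- s) cabs (h0 x).
have W0 : 0 <= W by apply: sumr_ge0 => x _; exact: cabs_ge0.
exists s, (e / (4 * (Dn p T + 1) * (W + 1))); split.
  by rewrite divr_gt0// !mulr_gt0// ltr_wpDl.
move=> v _ /ballP[iv nv] hv.
have [ih _] := fsupp_dlt us hs.
have [ivuh nvuh] := An_mul cG p1 iv iuh.
have [ivh _] := An_mul cG p1 iv ih.
pose w x := pmul v h0 x - h0 x.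
have hw x : x \notin s -> w x = 0 by move=> /hs h; rewrite /w /pmul h mulr0 subr0.
have [iw Tw] := fsupp_dlt us hw.
have b1 : cabs (T (pmul v (fun x => u x - h0 x))) <= Dn p T * An p (fun x => u x - h0 x).
  rewrite (le_trans (Dn_bound p1 hT ivuh))// ler_wpM2l// (le_trans nvuh)//.
  by rewrite ler_piMl ?An_ge0.
have b2 := Dn_bound p1 hT iuh.
have b3 : cabs (T w) <= e / (4 * (Dn p T + 1) * (W + 1)) * W * Dn p T.
  rewrite (Tw _ hT) (le_trans (cabs_sum _ _))// /W mulr_sumr mulr_suml.
  rewrite big_seq [leRHS]big_seq; apply: ler_sum => x xs.
  rewrite cabsM; apply: ler_pM; rewrite ?cabs_ge0//.
    rewrite /w /pmul (_ : _ - _ = (v x - 1) * h0 x); last by ring.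
    by rewrite cabsM ler_wpM2r ?cabs_ge0// ltW// hv.
  apply: (Dn_ball p1 hT); exact: Ap_dlt.
(* The first two terms are small because h0 is close to [u] and [v] is in the ball; the last is
   finitely supported, and small because [v] is close to 1 on the support of h0. *)
have -> : T (pmul v u) - T u =
    T (pmul v (fun x => u x - h0 x)) - T (fun x => u x - h0 x) + T w.
  have E1 : pmul v u = fun x => pmul v (fun x => u x - h0 x) x + pmul v h0 x.
    by apply/funext => x; rewrite /pmul; ring.
  rewrite /w (dualB lT ivh ih) (dualB lT hu ih) E1 (dualD lT ivuh ivh).
  ring.
rewrite (le_lt_trans (cabsD _ _))// (le_lt_trans (lerD (cabsB _ _) (lexx _)))//.
exact: (unit_error D0 W0 (An_ge0 p1 _) e0 b1 b2 b3 nuh).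
Qed.

Lemma approximate_unit_seq T (us : seq (G -> C)) (e : R) : in_Ap_dual p T -> 0 < e ->
  (forall u, List.In u us -> in_Ap p u) ->
  exists (E : seq G) (d : R), 0 < d /\ forall v, fsupp v -> Ap_ball p v ->
    (forall x, x \in E -> cabs (v x - 1) < d) ->
    forall u, List.In u us -> cabs (T (pmul v u) - T u) < e.
Proof.
move=> hT e0; elim: us => [|u us IH] hus; first by exists [::], 1.
have [E1 [d1 [d10 h1]]] := approximate_unit_dual hT (hus u (or_introl erefl)) e0.
have [E2 [d2 [d20 h2]]] := IH (fun u' h => hus u' (or_intror h)).
exists (E1 ++ E2), (Num.min d1 d2); split; first by rewrite lt_min d10.
move=> v sv bv hv u' [<-|].
  apply: h1 => // x xE; apply: lt_le_trans (hv x _) _; first by rewrite mem_cat xE.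
  by rewrite ge_min lexx.
apply: h2 => // x xE; apply: lt_le_trans (hv x _) _; first by rewrite mem_cat xE orbT.
by rewrite ge_min lexx orbT.
Qed.

Lemma Zp_approx T (us : seq (G -> C)) (M e : R) : in_Ap_dual p T -> 0 < M ->
  Dn p T <= M -> 0 < e -> (forall u, List.In u us -> in_Ap p u) ->
  exists2 phi, in_Zp p phi &
    forall u, List.In u us -> cabs (ofR M * phi u - T u) < e.
Proof.
move=> hT M0 TM e0 hus.
have [E [d [d0 h]]] := approximate_unit_seq hT e0 hus.
have [v sv [bv hv]] := approximate_unit E d0.
have [iv nv] := (ballP p v).1 bv.
have [hS nS] := in_dual_rmul cG p1 hT iv.
(* Multiplication by [v] does not raise the norm above [Dn p T <= M], so division by [M] lands in
   the unit ball of the dual. *)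
pose phi u := ofR M^-1 * dual_rmul T v u.
have Mn0 : M != 0 by rewrite gt_eqF.
have hphi : in_Ap_dual p phi.
  have := in_Ap_dual_lin p1 (ofR M^-1) hS (in_Ap_dual0 G p1).
  by under eq_fun do rewrite addr0.
exists phi; last first.
  by move=> u hu; rewrite /phi mulrA -ofRM divff// mul1r; exact: h.
split.
  have [s0 hs0] := sv; pose s := undup s0.
  exists [seq (ofR M^-1 * (v x * T (dlt R x)), x) | x <- s] => u hu.
  have hw x : x \notin s -> pmul v u x = 0.
    by rewrite mem_undup => /hs0 hx; rewrite /pmul hx mul0r.
  have [_ Tw] := fsupp_dlt (undup_uniq s0) hw.
  rewrite /phi /dual_rmul Tw// big_map mulr_sumr; apply: eq_bigr => x _ /=.
  by rewrite /pmul; ring.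
split=> //; rewrite -DnE; apply: (Dn_le p1) => u bu.
rewrite /phi cabsM cabs_ofR ger0_norm ?invr_ge0 ?(ltW M0)// ler_pdivrMl// mulr1.
rewrite (le_trans (Dn_ball p1 hS bu))// (le_trans nS)// (le_trans _ TM)//.
by rewrite ler_piMr ?(Dn_ge0 p1).
Qed.

End ApproximateIdentity.

(** * From disjoint closures to the failure of Arens regularity *)

Section ClosuresRegular.
Variables (R : realType) (G : groupType) (p : R).
Hypotheses (cG : countable [set: G]) (p1 : 1 < p) (aG : amenable R G).
Local Notation C := (Cx R).

Lemma In_map (A : eqType) (B : Type) (F : A -> B) (s : seq A) x :
  List.In x (map F s) <-> exists2 a, a \in s & x = F a.
Proof.
elim: s => [|a s IH] /=; first by split=> // -[].
split=> [[<-|/IH[b bs ->]]|[b]].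
- by exists a; rewrite ?inE ?eqxx.
- by exists b; rewrite ?inE ?bs ?orbT.
- rewrite inE => /predU1P[-> ->|bs xb]; first by left.
  by right; apply/IH; exists b.
Qed.

Section Choice.
Variables (F H : ((G -> C) -> C) -> C) (T : (G -> C) -> C) (MF MH e : R).
Hypotheses (hF : in_Ap_bidual p F) (hH : in_Ap_bidual p H) (hT : in_Ap_dual p T).
Hypotheses (MF0 : 0 < MF) (MH0 : 0 < MH) (e0 : 0 < e).
Hypothesis hMF : forall S, in_Ap_dual p S -> cabs (F S) <= MF * Dn p S.
Hypothesis hMH : forall S, in_Ap_dual p S -> cabs (H S) <= MH * Dn p S.

(** [hist] holds the pairs already chosen. The new first component imitates [F] and the new second
    one imitates [H], both on the functionals that define the two Arens products at [T] and on the
    slices of [T] through the old pairs. [MF] and [MH] are the scales that [helly] requires. *)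
Definition new_pair (hist : seq ((G -> C) * (G -> C))) (fg : (G -> C) * (G -> C)) :=
  [/\ Ap_ball p fg.1, Ap_ball p fg.2,
      cabs (ofR MF * bidual_dual H T fg.1 - F (bidual_dual H T)) < e,
      cabs (ofR MH * bidual_dual F T fg.2 - H (bidual_dual F T)) < e &
      forall x, List.In x hist ->
        cabs (ofR MF * T (pmul fg.1 x.2) - bidual_dual F T x.2) < e /\
        cabs (ofR MH * T (pmul x.1 fg.2) - bidual_dual H T x.1) < e].

Lemma new_pair_ex hist :
  (forall x, List.In x hist -> Ap_ball p x.1 /\ Ap_ball p x.2) ->
  exists fg, new_pair hist fg.
Proof.
move=> hh.
have Inm (K : (G -> C) * (G -> C) -> (G -> C) -> C) S :
    List.In S (map K hist) -> exists2 x, List.In x hist & S = K x.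
  elim: (hist) => [//|x s IH] /= [<-|/IH[y ys ->]]; first by exists x; [left|].
  by exists y; [right|].
have mIn (K : (G -> C) * (G -> C) -> (G -> C) -> C) x :
    List.In x hist -> List.In (K x) (map K hist).
  by elim: (hist) => [//|y s IH] /= [->|/IH]; [left|right].
have dF := in_bidual_dual cG p1 hF hT; have dH := in_bidual_dual cG p1 hH hT.
have [|f bf hf] := helly p1 hF MF0 hMF e0
  (ss := bidual_dual H T :: map (fun x => dual_rmul T x.2) hist).
  move=> S /= [<- //|/Inm[x /hh[_ [hx _]] ->]].
  exact: (proj1 (in_dual_rmul cG p1 hT hx)).
have [|g bg hg] := helly p1 hH MH0 hMH e0
  (ss := bidual_dual F T :: map (fun x => dual_rmul T x.1) hist).
  move=> S /= [<- //|/Inm[x /hh[[hx _] _] ->]].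
  exact: (proj1 (in_dual_rmul cG p1 hT hx)).
exists (f, g); split=> //=.
- by apply: hf; left.
- by apply: hg; left.
- move=> x hx; split.
    rewrite pmulC; apply: (hf (dual_rmul T x.2)); right.
    exact: (mIn (fun x => dual_rmul T x.2)).
  apply: (hg (dual_rmul T x.1)); right.
  exact: (mIn (fun x => dual_rmul T x.1)).
Qed.

Lemma pair_sequence : exists fg : nat -> (G -> C) * (G -> C),
  [/\ forall n, Ap_ball p (fg n).1, forall n, Ap_ball p (fg n).2,
      forall n, cabs (ofR MF * bidual_dual H T (fg n).1 - F (bidual_dual H T)) < e,
      forall n, cabs (ofR MH * bidual_dual F T (fg n).2 - H (bidual_dual F T)) < e &
      forall m n, (m < n)%N ->
        cabs (ofR MF * T (pmul (fg n).1 (fg m).2) - bidual_dual F T (fg m).2) < e /\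
        cabs (ofR MH * T (pmul (fg m).1 (fg n).2) - bidual_dual H T (fg m).1) < e].
Proof.
(* The choice function must be total, so a history that leaves the ball receives a dummy pair; by
   [bh] it never occurs. *)
have /choice[next hnext] hist : exists fg,
    (forall x, List.In x hist -> Ap_ball p x.1 /\ Ap_ball p x.2) -> new_pair hist fg.
  have [/new_pair_ex[fg h]|h] :=
    pselect (forall x, List.In x hist -> Ap_ball p x.1 /\ Ap_ball p x.2).
    by exists fg.
  by exists (fun=> 0, fun=> 0) => /h.
pose hist n := iter n (fun h => next h :: h) [::].
have bh n : forall x, List.In x (hist n) -> Ap_ball p x.1 /\ Ap_ball p x.2.
  elim: n => [//|n IH] x /= [<-|/IH//].
  by have [h1 h2 _ _ _] := hnext _ IH; split; [exact: h1|exact: h2].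
have hin m n : (m < n)%N -> List.In (next (hist m)) (hist n).
  elim: n => [//|n IH]; rewrite ltnS leq_eqVlt => /predU1P[->|/IH h].
    by left.
  by right.
exists (fun n => next (hist n)); split.
- by move=> n; have [h _ _ _ _] := hnext _ (bh n); exact: h.
- by move=> n; have [_ h _ _ _] := hnext _ (bh n); exact: h.
- by move=> n; have [_ _ h _ _] := hnext _ (bh n); exact: h.
- by move=> n; have [_ _ _ h _] := hnext _ (bh n); exact: h.
- by move=> m n /hin mn; have [_ _ _ _ h] := hnext _ (bh n); exact: h.
Qed.

End Choice.

Lemma closures_regular :
  (forall (f g : nat -> G -> C) (phi : nat -> (G -> C) -> C),
    (forall n, Ap_ball p (f n)) -> (forall m, Ap_ball p (g m)) ->
    (forall k, in_Zp p (phi k)) ->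
    closure [set z : C | exists n m k : nat,
               [/\ (m < n)%N, (n < k)%N & z = phi k (pmul (f n) (g m))]]
    `&`
    closure [set z : C | exists n m k : nat,
               [/\ (n < m)%N, (m < k)%N & z = phi k (pmul (f n) (g m))]]
    !=set0) -> Ap_Arens_regular G p.
Proof.
move=> h3 F H hF hH T hT; apply: contrapT => ne.
have {ne} : arens1 F H T <> arens2 F H T by [].
rewrite /arens1 /arens2 dual_bidualE.
set al := F _; set be := H _ => ne.
have [MF MF0 hMF] := bidual_bound p1 hF.
have [MH MH0 hMH] := bidual_bound p1 hH.
have D0 := Dn_ge0 p1 hT.
pose M := Dn p T + 1; have M0 : 0 < M by rewrite ltr_wpDl.
have TM : Dn p T <= M by rewrite lerDl.
pose dl := cabs (al - be).
have dl0 : 0 < dl.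
  rewrite lt_def cabs_ge0 andbT; apply/eqP => /cabs_eq0/eqP.
  by rewrite subr_eq0 => /eqP.
(* For {A, B} = {MF, MH} the errors in [near_c] add up to (A B + A + 1) e, which is at most ka e =
   dl/4. With the dl/8 left for the closure point the total stays below dl/2. *)
pose ka := (MF + 1) * (MH + 1).
have ka0 : 0 < ka by rewrite mulr_gt0// ltr_wpDl// ltW.
pose e := dl / (4 * ka); have e0 : 0 < e by rewrite divr_gt0// mulr_gt0.
have eka : e * ka = dl / 4 by rewrite /e; field; rewrite gt_eqF.
have [fg [b1 b2 hfa hgb hfg]] := pair_sequence hF hH hT MF0 MH0 e0 hMF hMH.
pose us k := map (fun ij : nat * nat => pmul (fg ij.1).1 (fg ij.2).2)
  [seq (i, j) | i <- iota 0 k, j <- iota 0 k].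
have /choice[phi hphi] k : exists phi, in_Zp p phi /\
    forall u, List.In u (us k) -> cabs (ofR M * phi u - T u) < e.
  have [phi h1 h2] := Zp_approx cG p1 aG hT M0 TM e0 (us := us k) (ltac:(
    move=> u /In_map[ij _ ->];
    exact: (proj1 (An_mul cG p1 (proj1 (b1 ij.1)) (proj1 (b2 ij.2)))))).
  by exists phi.
have hpk n m k : (n < k)%N -> (m < k)%N ->
    cabs (ofR M * phi k (pmul (fg n).1 (fg m).2) - T (pmul (fg n).1 (fg m).2)) < e.
  move=> nk mk; have [_ h] := hphi k; apply: h; apply/In_map.
  by exists (n, m) => //; apply/allpairsP; exists (n, m); rewrite !mem_iota.
have [z [z1 z2]] := h3 (fun n => (fg n).1) (fun n => (fg n).2) phi b1 b2
  (fun k => proj1 (hphi k)).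
(* The accumulated scale: [M] from passing to [phi k], and [MF] and [MH] from the two uses of
   [helly]. *)
pose Q := MF * MH * M; have Q0 : 0 < Q by rewrite !mulr_gt0.
have near_c (A B : R) (x y t w c : C) : 0 < A -> 0 < B -> (A + 1) * (B + 1) = ka ->
    A * B * M = Q -> cabs (ofR M * x - t) < e -> cabs (ofR B * t - y) < e ->
    cabs (ofR A * y - c) < e -> cabs (w - x) < dl / (8 * Q) ->
    cabs (ofR Q * w - c) < dl / 2.
  move=> A0 B0 ABk EQ hx ht hy hw.
  have -> : ofR Q * w - c = ofR Q * (w - x) + ofR (A * B) * (ofR M * x - t) +
      ofR A * (ofR B * t - y) + (ofR A * y - c).
    by rewrite -EQ !ofRM; ring.
  have AB0 : 0 < A * B by rewrite mulr_gt0.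
  have k1 : cabs (ofR Q * (w - x)) < dl / 8.
    rewrite cabsM cabs_ofR gtr0_norm// mulrC -ltr_pdivlMr//.
    by rewrite -mulrA -invfM.
  have k2 : cabs (ofR (A * B) * (ofR M * x - t)) <= A * B * e.
    by rewrite cabsM cabs_ofR gtr0_norm// ler_pM2l// ltW.
  have k3 : cabs (ofR A * (ofR B * t - y)) <= A * e.
    by rewrite cabsM cabs_ofR gtr0_norm// ler_pM2l// ltW.
  have k4 : (A * B + A + 1) * e <= dl / 4.
    by rewrite -eka mulrC ler_pM2l// -ABk; nra.
  rewrite (le_lt_trans (cabsD _ _))//.
  rewrite (le_lt_trans (lerD (cabsD _ _) (lexx _)))//.
  rewrite (le_lt_trans (lerD (lerD (cabsD _ _) (lexx _)) (lexx _)))//.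
  lra.
have r0 : 0 < dl / (8 * Q) by rewrite divr_gt0// mulr_gt0.
have [_ [n [m [k [mn nk ->]]]] hz1] := (closure_cabsP _ _).1 z1 _ r0.
have [_ [n' [m' [k' [nm' mk' ->]]]] hz2] := (closure_cabsP _ _).1 z2 _ r0.
(* When [m < n], the later element f_n replaces [F] against the fixed g_m, and then g_m replaces
   [H]: the value is [be]. In the other order the roles of [F] and [H] are exchanged and the value
   is [al], at distance [dl] from [be]. *)
have c1 : cabs (ofR Q * z - be) < dl / 2.
  apply: (near_c MH MF _ _ _ _ _ MH0 MF0 _ _ (hpk n m k nk (ltn_trans mn nk))
    (proj1 (hfg _ _ mn)) (hgb m) hz1).
  - by rewrite mulrC.
  - by rewrite /Q (mulrC MF).
have c2 : cabs (ofR Q * z - al) < dl / 2.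
  exact: (near_c MF MH _ _ _ _ _ MF0 MH0 erefl erefl
    (hpk n' m' k' (ltn_trans nm' mk') mk') (proj2 (hfg _ _ nm')) (hfa n') hz2).
have := cabs_triangle al (ofR Q * z) be; rewrite (cabs_distC al (ofR Q * z)) -/dl; lra.
Qed.

End ClosuresRegular.

Theorem theorem3p5 (R : realType) (G : groupType) (p : R) :
  countable [set: G] -> amenable R G -> 1 < p ->
  [<-> (* (i) *) Ap_Arens_regular G p;
       (* (ii) *)
       forall (f g : nat -> G -> Cx R) (phi : nat -> (G -> Cx R) -> Cx R),
         (forall n, Ap_ball p (f n)) -> (forall m, Ap_ball p (g m)) ->
         (forall k, in_Zp p (phi k)) ->
         forall L L' : Cx R,
           iterlim_nmk (fun n m k => phi k (pmul (f n) (g m))) L ->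
           iterlim_mnk (fun n m k => phi k (pmul (f n) (g m))) L' ->
           L = L';
       (* (iii) *)
       forall (f g : nat -> G -> Cx R) (phi : nat -> (G -> Cx R) -> Cx R),
         (forall n, Ap_ball p (f n)) -> (forall m, Ap_ball p (g m)) ->
         (forall k, in_Zp p (phi k)) ->
         closure [set z : Cx R | exists n m k : nat,
                    [/\ (m < n)%N, (n < k)%N & z = phi k (pmul (f n) (g m))]]
         `&`
         closure [set z : Cx R | exists n m k : nat,
                    [/\ (n < m)%N, (m < k)%N & z = phi k (pmul (f n) (g m))]]
         !=set0].
Proof.
move=> cG aG p1; tfae.
- exact: regular_iterated.
- exact: iterated_closures.
- exact: closures_regular.
Qed.
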